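(* The group $B_3/[B_3[3],B_3[3]]$ is a Bieberbach group with holonomy group $\mathrm{PSp}_2(\mathbb{Z}/3\mathbb{Z})$.
   Context: $B_3=\langle \sigma_1,\sigma_2\mid \sigma_1\sigma_2\sigma_1=\sigma_2\sigma_1\sigma_2\rangle$ is the braid group on three strands. $\rho_3\colon B_3\to \mathrm{Sp}_2(\mathbb{Z}/3\mathbb{Z})=\mathrm{SL}_2(\mathbb{Z}/3\mathbb{Z})$ is the homomorphism (integral Burau representation at $t=-1$, reduced mod $3$) given by $\sigma_1\mapsto\begin{pmatrix}1&1\\0&1\end{pmatrix}$, $\sigma_2\mapsto\begin{pmatrix}1&0\\-1&1\end{pmatrix}$, and $B_3[3]=\ker\rho_3$ is the level $3$ congruence subgroup. $\mathrm{PSp}_2(\mathbb{Z}/3\mathbb{Z})$ is the quotient of $\mathrm{Sp}_2(\mathbb{Z}/3\mathbb{Z})$ by its center. A group is crystallographic of dimension $d$ if it is (isomorphic to) a discrete uniform (i.e. cocompact) subgroup of $\mathbb{R}^d\rtimes \mathrm{O}(d,\mathbb{R})$. Equivalently, $\Pi$ is crystallographic of dimension $d$ with holonomy group $\Phi$ if $\Phi$ is finite and there is a short exact sequence $0\to\mathbb{Z}^d\to\Pi\to\Phi\to1$ such that the representation $\Phi\to\mathrm{Aut}(\mathbb{Z}^d)$ induced by conjugation is faithful. A Bieberbach group is a torsion-free crystallographic group. *)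

(* Defs.v *)
From HB Require Import structures.
From mathcomp Require Import all_boot all_order all_algebra all_fingroup.
From mathcomp Require Import generic_quotient center.
From mathcomp Require Import ring.
From mathcomp Require Import all_classical all_reals all_analysis.
Import numFieldNormedType.Exports.

Set Implicit Arguments.
Unset Strict Implicit.
Unset Printing Implicit Defensive.

Import Order.TTheory GRing.Theory Num.Theory.

Local Open Scope classical_set_scope.
Local Open Scope group_scope.
Local Open Scope quotient_scope.

HB.mixin Record isConjClosed (G : groupType) (S : {pred G}) := {
  gpredJ : forall x y : G, x \in S -> x ^ y \in S
}.

#[short(type="normalClosed")]
HB.structure Definition NormalClosed (G : groupType) :=
  {S of isConjClosed G S & GroupClosed G S}.

Section Cosets.
Variable G : groupType.

Section Coset.
Variable S : groupClosed G.

Definition lcoset_rel : rel G := fun x y => x^-1 * y \in S.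

Lemma lcoset_rel_refl : reflexive lcoset_rel.
Proof. by move=> x; rewrite /lcoset_rel mulVg gpred1. Qed.

Lemma lcoset_rel_sym : symmetric lcoset_rel.
Proof.
by move=> x y; apply/idP/idP => /gpredVr; rewrite /lcoset_rel invgM invgK.
Qed.

Lemma lcoset_rel_trans : transitive lcoset_rel.
Proof.
move=> y x z xy yz; rewrite /lcoset_rel.
by have := gpredM _ _ xy yz; rewrite mulgA mulgK.
Qed.

Canonical lcoset_equiv :=
  EquivRel lcoset_rel lcoset_rel_refl lcoset_rel_sym lcoset_rel_trans.

Definition coset_space := {eq_quot lcoset_equiv}.
HB.instance Definition _ := Choice.on coset_space.
HB.instance Definition _ := EqQuotient.on coset_space.

End Coset.

Section Quotient.
Variable N : normalClosed G.

Definition quotient_group := coset_space N.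
HB.instance Definition _ := Choice.on quotient_group.
HB.instance Definition _ := EqQuotient.on quotient_group.

Definition quotg_one : quotient_group := \pi_quotient_group 1.
Definition quotg_inv (x : quotient_group) : quotient_group :=
  \pi_quotient_group ((repr x)^-1).
Definition quotg_mul (x y : quotient_group) : quotient_group :=
  \pi_quotient_group (repr x * repr y).

Lemma quotg_eqP (x y : G) :
  reflect (\pi_quotient_group x = \pi_quotient_group y) (x^-1 * y \in N).
Proof. exact: (@eqquotP _ (lcoset_equiv N) quotient_group x y). Qed.

Lemma quotg_reprP (x : G) : (repr (\pi_quotient_group x))^-1 * x \in N.
Proof. by apply/quotg_eqP; rewrite reprK. Qed.

Lemma quotg_piV (x : G) :
  quotg_inv (\pi_quotient_group x) = \pi_quotient_group (x^-1).
Proof.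
rewrite /quotg_inv; apply/quotg_eqP; rewrite invgK.
have /gpredVr/(gpredJ _ x^-1) := quotg_reprP x.
by rewrite conjgE invgK invgM invgK !mulgA mulgV mul1g.
Qed.

Lemma quotg_piM (x y : G) :
  quotg_mul (\pi_quotient_group x) (\pi_quotient_group y) =
  \pi_quotient_group (x * y).
Proof.
rewrite /quotg_mul; apply/quotg_eqP.
have /(gpredJ _ (repr (\pi_quotient_group y))) Nx := quotg_reprP x.
have := gpredM _ _ Nx (quotg_reprP y).
by rewrite conjgE invgM !mulgA mulgK.
Qed.

Lemma quotg_mulA : associative quotg_mul.
Proof.
elim/quotW=> x; elim/quotW=> y; elim/quotW=> z.
by rewrite (quotg_piM y) (quotg_piM x y) !quotg_piM mulgA.
Qed.

Lemma quotg_mul1 : left_id quotg_one quotg_mul.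
Proof. by move=> x; rewrite -[x]reprK quotg_piM mul1g. Qed.

Lemma quotg_mulr1 : right_id quotg_one quotg_mul.
Proof. by move=> x; rewrite -[x]reprK quotg_piM mulg1. Qed.

Lemma quotg_mulV : left_inverse quotg_one quotg_inv quotg_mul.
Proof. by move=> x; rewrite -[x]reprK quotg_piV quotg_piM mulVg. Qed.

Lemma quotg_mulrV : right_inverse quotg_one quotg_inv quotg_mul.
Proof. by move=> x; rewrite -[x]reprK quotg_piV quotg_piM mulgV. Qed.

HB.instance Definition _ := isGroup.Build quotient_group
  quotg_mulA quotg_mul1 quotg_mulr1 quotg_mulV quotg_mulrV.

End Quotient.
End Cosets.

Section Kernel.
Variables (G H : groupType) (f : {multiplicative G -> H}).

Definition kernel : {pred G} := fun x => f x == 1.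

Lemma kernel_f1 : f 1 = 1.
Proof. by apply: (mulgI (f 1)); rewrite -gmulfM !mulg1. Qed.

Lemma kernel_fV x : f x^-1 = (f x)^-1.
Proof. by apply: (mulgI (f x)); rewrite -gmulfM !mulgV kernel_f1. Qed.

Lemma kernel1 : 1 \in kernel.
Proof. by rewrite unfold_in kernel_f1. Qed.

Lemma kernelM : mulg_closed kernel.
Proof.
by move=> x y /eqP fx /eqP fy; rewrite unfold_in gmulfM fx fy mulg1.
Qed.

Lemma kernelV : invg_closed kernel.
Proof. by move=> x /eqP fx; rewrite unfold_in kernel_fV fx invg1. Qed.

Lemma kernelJ x y : x \in kernel -> x ^ y \in kernel.
Proof.
by move=> /eqP fx; rewrite unfold_in conjgE !gmulfM fx kernel_fV mul1g mulVg.
Qed.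

HB.instance Definition _ := isMulClosed.Build G kernel kernelM.
HB.instance Definition _ := isMul1Closed.Build G kernel kernel1.
HB.instance Definition _ := isInvClosed.Build G kernel kernelV.
HB.instance Definition _ := isConjClosed.Build G kernel kernelJ.

End Kernel.

Inductive generated (G : groupType) (A : set G) : set G :=
| generated1 : generated A 1
| generated_sub x : A x -> generated A x
| generatedM x y : generated A x -> generated A y -> generated A (x * y)
| generatedV x : generated A x -> generated A x^-1.

Section DerivedSubgroup.
Variables (G : groupType) (N : normalClosed G).

Definition derived : {pred G} :=
  mem (generated [set [~ x, y] | x in [set` N] & y in [set` N]]).

Lemma derived1 : 1 \in derived.
Proof. by rewrite inE; exact: generated1. Qed.

Lemma derivedM : mulg_closed derived.
Proof. by move=> x y; rewrite !inE; exact: generatedM. Qed.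

Lemma derivedV : invg_closed derived.
Proof. by move=> x; rewrite !inE; exact: generatedV. Qed.

Lemma derivedJ x z : x \in derived -> x ^ z \in derived.
Proof.
rewrite !inE; elim=> {x} [|x [a Na [b Nb <-]]|x y _ IHx _ IHy|x _ IHx].
- by rewrite conj1g; exact: generated1.
- apply: generated_sub; rewrite conjRg.
  exists (a ^ z); first exact: gpredJ Na.
  by exists (b ^ z) => //; exact: gpredJ Nb.
- by rewrite conjMg; exact: generatedM.
- by rewrite conjVg; exact: generatedV.
Qed.

HB.instance Definition _ := isMulClosed.Build G derived derivedM.
HB.instance Definition _ := isMul1Closed.Build G derived derived1.
HB.instance Definition _ := isInvClosed.Build G derived derivedV.
HB.instance Definition _ := isConjClosed.Build G derived derivedJ.

End DerivedSubgroup.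

(* The letter [(x, b)] stands for the generator [x] if [b = false] and for its
   inverse if [b = true]. *)
Definition word (X : choiceType) := seq (X * bool).

Section Presentation.
Variables (X : choiceType) (relation : word X -> word X -> Prop).

Inductive word_eq : word X -> word X -> Prop :=
| word_eq_refl u : word_eq u u
| word_eq_sym u v : word_eq u v -> word_eq v u
| word_eq_trans v u w : word_eq u v -> word_eq v w -> word_eq u w
| word_eq_cat u u' v v' :
    word_eq u u' -> word_eq v v' -> word_eq (u ++ v) (u' ++ v')
| word_eq_cancel x b : word_eq [:: (x, b); (x, ~~ b)] [::]
| word_eq_relation u v : relation u v -> word_eq u v.

Definition word_rel : rel (word X) := fun u v => `[< word_eq u v >].

Lemma word_rel_refl : reflexive word_rel.
Proof. by move=> u; apply/asboolP; exact: word_eq_refl. Qed.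

Lemma word_rel_sym : symmetric word_rel.
Proof. by move=> u v; apply/asboolP/asboolP; exact: word_eq_sym. Qed.

Lemma word_rel_trans : transitive word_rel.
Proof.
by move=> v u w /asboolP uv /asboolP vw; apply/asboolP; exact: word_eq_trans vw.
Qed.

Canonical word_equiv :=
  EquivRel word_rel word_rel_refl word_rel_sym word_rel_trans.

Definition presented := {eq_quot word_equiv}.
HB.instance Definition _ := Choice.on presented.
HB.instance Definition _ := EqQuotient.on presented.

Lemma presented_eqP (u v : word X) :
  word_eq u v <-> \pi_presented u = \pi_presented v.
Proof.
split=> [uv|/(@eqquotP _ word_equiv presented u v)/asboolP//].
by apply/(@eqquotP _ word_equiv presented u v)/asboolP.
Qed.

Lemma presented_reprP (u : word X) : word_eq (repr (\pi_presented u)) u.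
Proof. by apply/presented_eqP; rewrite reprK. Qed.

Definition word_inv (u : word X) : word X := rev [seq (l.1, ~~ l.2) | l <- u].

Lemma word_eq_mulV w : word_eq (word_inv w ++ w) [::].
Proof.
elim: w => [|[x b] w IHw]; first exact: word_eq_refl.
rewrite /word_inv /= rev_cons -cats1 -catA -/(word_inv w).
apply: word_eq_trans IHw; apply: word_eq_cat; first exact: word_eq_refl.
apply: (@word_eq_cat [:: (x, ~~ b); (x, b)] [::] w w).
  by have := word_eq_cancel x (~~ b); rewrite negbK.
exact: word_eq_refl.
Qed.

Lemma word_invK : involutive word_inv.
Proof.
move=> u; rewrite /word_inv map_rev revK -map_comp.
by rewrite (eq_map (g := id)) ?map_id // => -[x b] /=; rewrite negbK.
Qed.

Lemma word_eq_inv u v : word_eq u v -> word_eq (word_inv u) (word_inv v).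
Proof.
have mulwV w : word_eq (w ++ word_inv w) [::].
  by have := word_eq_mulV (word_inv w); rewrite word_invK.
move=> uv; apply: (@word_eq_trans (word_inv u ++ (v ++ word_inv v))).
  rewrite -{1}[word_inv u]cats0; apply: word_eq_cat; first exact: word_eq_refl.
  exact: word_eq_sym.
rewrite catA -[word_inv v in X in word_eq _ X]cat0s.
apply: word_eq_cat; last exact: word_eq_refl.
apply: word_eq_trans (word_eq_mulV u).
apply: word_eq_cat; first exact: word_eq_refl.
exact: word_eq_sym.
Qed.

Definition presented_one : presented := \pi_presented [::].
Definition presented_inv (x : presented) : presented :=
  \pi_presented (word_inv (repr x)).
Definition presented_mul (x y : presented) : presented :=
  \pi_presented (repr x ++ repr y).

Lemma presented_piM u v :
  presented_mul (\pi_presented u) (\pi_presented v) = \pi_presented (u ++ v).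
Proof.
by apply/presented_eqP; apply: word_eq_cat; exact: presented_reprP.
Qed.

Lemma presented_piV u :
  presented_inv (\pi_presented u) = \pi_presented (word_inv u).
Proof. by apply/presented_eqP; apply: word_eq_inv; exact: presented_reprP. Qed.

Lemma presented_mulA : associative presented_mul.
Proof.
elim/quotW=> x; elim/quotW=> y; elim/quotW=> z.
by rewrite (presented_piM y) (presented_piM x y) !presented_piM catA.
Qed.

Lemma presented_mul1 : left_id presented_one presented_mul.
Proof. by move=> x; rewrite -[x]reprK presented_piM. Qed.

Lemma presented_mulr1 : right_id presented_one presented_mul.
Proof. by move=> x; rewrite -[x]reprK presented_piM cats0. Qed.

Lemma presented_mulV : left_inverse presented_one presented_inv presented_mul.
Proof.
elim/quotW=> u; rewrite presented_piV presented_piM.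
exact/presented_eqP/word_eq_mulV.
Qed.

Lemma presented_mulrV :
  right_inverse presented_one presented_inv presented_mul.
Proof.
elim/quotW=> u; rewrite presented_piV presented_piM; apply/presented_eqP.
by have := word_eq_mulV (word_inv u); rewrite word_invK.
Qed.

HB.instance Definition _ := isGroup.Build presented presented_mulA
  presented_mul1 presented_mulr1 presented_mulV presented_mulrV.

Definition presented_gen (x : X) : presented := \pi_presented [:: (x, false)].

Section Lift.
Variables (H : groupType) (f : X -> H).

Definition word_eval (u : word X) : H :=
  \prod_(l <- u) (if l.2 then (f l.1)^-1 else f l.1).

Hypothesis f_relation :
  forall u v, relation u v -> word_eval u = word_eval v.

Lemma word_eval_eq u v : word_eq u v -> word_eval u = word_eval v.
Proof.
elim=> {u v} // [v u w _ -> _ -> //|u u' v v' _ IHu _ IHv|x b].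
  by rewrite /word_eval !big_cat /= -!/(word_eval _) IHu IHv.
rewrite /word_eval !big_cons !big_nil /= mulg1.
by case: b; rewrite /= ?mulVg ?mulgV.
Qed.

Definition presented_lift
    (_ : forall u v, relation u v -> word_eval u = word_eval v)
    (x : presented) : H :=
  word_eval (repr x).

Lemma presented_lift_pi u :
  presented_lift f_relation (\pi_presented u) = word_eval u.
Proof. exact/word_eval_eq/presented_reprP. Qed.

Lemma presented_lift_gen x :
  presented_lift f_relation (presented_gen x) = f x.
Proof. by rewrite presented_lift_pi /word_eval big_seq1. Qed.

Lemma presented_liftM : {morph presented_lift f_relation : x y / x * y}.
Proof.
move=> x y; rewrite -[x]reprK -[y]reprK.
rewrite -[_ * _]/(presented_mul _ _) presented_piM !presented_lift_pi.
by rewrite /word_eval big_cat.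
Qed.

End Lift.

HB.instance Definition _ (H : groupType) (f : X -> H)
    (fr : forall u v, relation u v -> word_eval f u = word_eval f v) :=
  isMultiplicative.Build presented H (presented_lift fr) (presented_liftM fr).

End Presentation.

(* The generators sigma_1, sigma_2 are [false] and [true]. *)
Definition braid3_relation (u v : word bool) : Prop :=
  let s1 := (false, false) in let s2 := (true, false) in
  u = [:: s1; s2; s1] /\ v = [:: s2; s1; s2].

Definition B3 := presented braid3_relation.
HB.instance Definition _ := Group.on B3.

Definition mx2 (R : Type) (a b c d : R) : 'M[R]_2 :=
  \matrix_(i, j) (if i == 0 :> nat then if j == 0 :> nat then a else b
                  else if j == 0 :> nat then c else d).

Definition symp_form : 'M['F_3]_2 := (mx2 0 1 (-1) 0)%R.

Definition Sp2_F3 : {set {'GL_2['F_3]}} :=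
  [set g : {'GL_2['F_3]} |
    ((GLval g)^T *m symp_form *m GLval g == symp_form)%R].

Lemma Sp2_F3_group_set : group_set Sp2_F3.
Proof.
apply/group_setP; split=> [|g h]; rewrite !inE.
  by rewrite GL_1E trmx1 mul1mx mulmx1.
move=> /eqP gJ /eqP hJ; rewrite GL_MxE trmx_mul -!mulmxA.
rewrite (mulmxA symp_form) (mulmxA _^T _ (GLval h)).
by rewrite [X in (_ *m (X *m _))%R]mulmxA gJ mulmxA hJ.
Qed.

Canonical Sp2_F3_group := Group Sp2_F3_group_set.

Lemma Sp2_F3_det (g : {'GL_2['F_3]}) :
  (g \in Sp2_F3) = (\det (GLval g) == 1)%R.
Proof.
have det2 : (\det (GLval g) = g 0 0 * g 1 1 - g 0 1 * g 1 0)%R.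
  rewrite (expand_det_row _ 0%R) !big_ord_recl big_ord0 /cofactor.
  rewrite !det_mx11 !mxE.
  rewrite !addr0 /= expr0 expr1 mul1r mulN1r mulrN.
  by congr (_ * _ - _ * _)%R; congr (fun_of_matrix _ _ _); apply/val_inj.
have gJ : ((GLval g)^T *m symp_form *m GLval g = \det (GLval g) *: symp_form)%R.
  have o1 : lift ord0 ord0 = 1%R :> 'I_2 by apply/val_inj.
  apply/matrixP=> i j; rewrite det2 !(mxE, big_ord_recl, big_ord0) !o1 /=.
  have [->|->] : i = 0%R \/ i = 1%R.
    by case: i => [[|[|//]] ?]; [left|right]; apply/val_inj.
  - have [->|->] : j = 0%R \/ j = 1%R.
      by case: j => [[|[|//]] ?]; [left|right]; apply/val_inj.
    + by rewrite /=; ring.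
    + by rewrite /=; ring.
  - have [->|->] : j = 0%R \/ j = 1%R.
      by case: j => [[|[|//]] ?]; [left|right]; apply/val_inj.
    + by rewrite /=; ring.
    + by rewrite /=; ring.
rewrite inE gJ; apply/eqP/eqP=> [|->]; last by rewrite scale1r.
by move=> /matrixP/(_ 0%R 1%R); rewrite !mxE /= mulr1.
Qed.

Lemma symp_form_unit : (symp_form \in unitmx)%R.
Proof.
suff /mulmx1_unit[] : (symp_form *m - symp_form = 1%:M)%R by [].
by apply/matrixP=> i j; rewrite !mxE !big_ord_recl big_ord0 !mxE;
  case: i => [[|[|//]] ?]; case: j => [[|[|//]] ?]; apply/val_inj.
Qed.

Lemma symp_unit (M : 'M['F_3]_2) :
  (M^T *m symp_form *m M = symp_form -> M \is a GRing.unit)%R.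
Proof.
move=> MJ; have := symp_form_unit; rewrite -MJ unitmx_mul.
by case/andP.
Qed.

Definition sigma_mx (b : bool) : 'M['F_3]_2 :=
  (if b then mx2 1 0 (-1) 1 else mx2 1 1 0 1)%R.

Lemma sigma_mx_symp b :
  ((sigma_mx b)^T *m symp_form *m sigma_mx b = symp_form)%R.
Proof.
by apply/matrixP=> i j; rewrite !(mxE, big_ord_recl, big_ord0); case: b;
  rewrite !mxE; case: i => [[|[|//]] ?]; case: j => [[|[|//]] ?]; apply/val_inj.
Qed.

Definition sigma_GL (b : bool) : {'GL_2['F_3]} :=
  FinRing.unit _ (symp_unit (sigma_mx_symp b)).

Lemma sigma_GL_Sp b : sigma_GL b \in Sp2_F3_group.
Proof. by rewrite inE; apply/eqP/sigma_mx_symp. Qed.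

Definition rho3_gen (b : bool) : [subg Sp2_F3_group] := Subg (sigma_GL_Sp b).

Lemma rho3_relation u v :
  braid3_relation u v -> word_eval rho3_gen u = word_eval rho3_gen v.
Proof.
case=> -> ->; rewrite /word_eval !big_cons !big_nil /= !mulg1.
apply/val_inj/val_inj/matrixP=> i j /=.
by rewrite !(mxE, big_ord_recl, big_ord0);
  case: i => [[|[|//]] ?]; case: j => [[|[|//]] ?]; apply/val_inj.
Qed.

Definition rho3 : {multiplicative B3 -> [subg Sp2_F3_group]} :=
  presented_lift rho3_relation.

Lemma rho3_gen_image b :
  GLval (sgval (rho3 (presented_gen braid3_relation b))) = sigma_mx b.
Proof. by rewrite /rho3 /= presented_lift_gen. Qed.

Definition B3_level3 : normalClosed B3 := kernel rho3.

Definition B3_mod_derived := quotient_group (derived B3_level3).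
HB.instance Definition _ := Group.on B3_mod_derived.

Definition PSp2_F3 : Type :=
  [subg quotient Sp2_F3_group 'Z(Sp2_F3_group)].
HB.instance Definition _ := FinGroup.on PSp2_F3.

Section Euclidean.
Variables (R : realType) (d : nat).

Definition euclid :=
  {p : 'cV[R]_d * 'M[R]_d | (p.2^T *m p.2 == 1%:M)%R}.

Implicit Types x y z : euclid.

Lemma euclid_mul_subproof x y :
  (((val x).2 *m (val y).2)^T *m ((val x).2 *m (val y).2) == 1%:M :> 'M[R]_d)%R.
Proof.
rewrite trmx_mul mulmxA -(mulmxA _ _ (val x).2) (eqP (valP x)) mulmx1.
exact: valP y.
Qed.

Lemma euclid_inv_subproof x :
  (((val x).2^T)^T *m (val x).2^T == 1%:M :> 'M[R]_d)%R.
Proof. by rewrite trmxK; apply/eqP/mulmx1C/eqP/(valP x). Qed.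

Lemma euclid_one_subproof : ((1%:M : 'M[R]_d)^T *m 1%:M == 1%:M)%R.
Proof. by rewrite trmx1 mulmx1. Qed.

Definition euclid_one : euclid := exist _ (0, 1%:M)%R euclid_one_subproof.

(* (v, A) (w, B) = (v + A w, A B), i.e. composition of the maps
   t |-> v + A t of R^d. *)
Definition euclid_mul x y : euclid :=
  exist _ ((val x).1 + (val x).2 *m (val y).1, (val x).2 *m (val y).2)%R
    (euclid_mul_subproof x y).

Definition euclid_inv x : euclid :=
  exist _ (- ((val x).2^T *m (val x).1), (val x).2^T)%R (euclid_inv_subproof x).

Lemma euclid_mulA : associative euclid_mul.
Proof.
move=> x y z; apply/val_inj; rewrite /= mulmxA; congr pair.
by rewrite mulmxDr addrA mulmxA.
Qed.

Lemma euclid_mul1 : left_id euclid_one euclid_mul.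
Proof.
move=> x; apply/val_inj; rewrite /= add0r !mul1mx.
by case: (val x).
Qed.

Lemma euclid_mulr1 : right_id euclid_one euclid_mul.
Proof.
move=> x; apply/val_inj; rewrite /= mulmx0 addr0 mulmx1.
by case: (val x).
Qed.

Lemma euclid_mulV : left_inverse euclid_one euclid_inv euclid_mul.
Proof.
move=> x; apply/val_inj; rewrite /= addNr; congr pair.
exact/eqP/(valP x).
Qed.

Lemma euclid_mulrV : right_inverse euclid_one euclid_inv euclid_mul.
Proof.
move=> x; have xV := mulmx1C (eqP (valP x)); apply/val_inj.
by rewrite /= mulmxN mulmxA xV mul1mx addrN.
Qed.

HB.instance Definition _ := Choice.on euclid.
HB.instance Definition _ := isGroup.Build euclid
  euclid_mulA euclid_mul1 euclid_mulr1 euclid_mulV euclid_mulrV.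

HB.instance Definition _ := Topological.copy euclid
  (initial_topology (val : euclid -> 'cV[R]_d * 'M[R]_d)).

End Euclidean.

Definition discrete_subgroup (R : realType) (d : nat)
    (Gamma : groupClosed (euclid R d)) : Prop :=
  forall x, x \in Gamma -> isolated [set` Gamma] x.

Definition uniform_subgroup (R : realType) (d : nat)
    (Gamma : groupClosed (euclid R d)) : Prop :=
  compact [set: quotient_topology (coset_space Gamma)].

Definition crystallographic (R : realType) (d : nat) (Pi : groupType) : Prop :=
  exists Gamma : groupClosed (euclid R d),
    [/\ discrete_subgroup Gamma, uniform_subgroup Gamma &
      exists f : {multiplicative Pi -> euclid R d},
        injective f /\ range f = [set` Gamma]].

Definition torsion_free (Pi : groupType) : Prop :=
  forall (x : Pi) (n : nat), (0 < n)%N -> x ^+ n = 1 -> x = 1.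

(* [rho] is forced by the other data: it is the conjugation action of Phi on Z^d
   in the extension 0 -> Z^d -> Pi -> Phi -> 1 given by [i] and [p]. *)
Definition has_holonomy (d : nat) (Pi : groupType) (Phi : finGroupType) :
    Prop :=
  exists (i : 'cV[int]_d -> Pi) (p : {multiplicative Pi -> Phi})
         (rho : Phi -> 'cV[int]_d -> 'cV[int]_d),
    [/\ injective i, {morph i : u v / (u + v)%R >-> u * v},
        range i = [set` kernel p], range p = setT &
        (forall g v, i (rho (p g) v) = g * i v * g^-1) /\ injective rho].

(* [crystallographic] is the geometric definition (discrete uniform subgroup of
   R^d x| O(d)); the holonomy group is specified by the algebraic extension, in
   the same dimension [d]. *)
Definition bieberbach_with_holonomy (R : realType) (Pi : groupType)
    (Phi : finGroupType) : Prop :=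
  exists d : nat,
    [/\ crystallographic R d Pi, torsion_free Pi & has_holonomy d Pi Phi].

(* Main.v *)
(* Write a, b for sigma_1, sigma_2, c = (ab)^3 for the central full twist, and
   e_0, ..., e_3 for the conjugates of a^3 attached to the four points of the
   projective line over F_3 (the cusps of the principal congruence subgroup of
   level 3). The relation c^2 = e_0 e_1 e_2 e_3 holds in B_3; the group N
   generated by c and the e_i is normal, and has the 12 coset representatives
   s_j a^m, where s_j moves the cusp 0 to the cusp j. Comparison with the images
   in Sp_2(F_3) shows that N is the preimage of the center of Sp_2(F_3), so it
   contains K = B_3[3]; modulo [K, K] it becomes abelian and is spanned by e_1,
   e_2, e_3, c.

   On the other side, B_3 acts on R^4 by affine maps whose linear parts permute
   the four coordinates as the cusps, with e_i acting as translation by the i-th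
   basis vector and c as translation by (1/2, 1/2, 1/2, 1/2). This action kills
   [K, K], and the images of e_1, e_2, e_3, c are linearly independent, so it
   embeds B_3/[K, K] as a crystallographic group whose lattice is the image of
   N. The group is torsion free because an element whose linear part is a
   3-cycle displaces the fixed coordinate by an element of 1/3 + Z/2 or
   2/3 + Z/2, and the square of an element whose linear part is a double
   transposition is a translation with some coordinate in 1/2 + Z. *)

From HB Require Import structures.
From mathcomp Require Import all_boot all_order all_algebra all_fingroup.
From mathcomp Require Import generic_quotient center.
From mathcomp Require Import ring zify.
From mathcomp Require Import all_classical all_reals all_analysis.
Require Import Defs.
Import numFieldNormedType.Exports.

Set Implicit Arguments.
Unset Strict Implicit.
Unset Printing Implicit Defensive.

Import Order.TTheory GRing.Theory Num.Theory.

Local Open Scope classical_set_scope.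
Local Open Scope group_scope.
Local Open Scope quotient_scope.

(** * Discrete and cocompact groups of isometries *)

Section EuclideanSubgroups.
Local Open Scope ring_scope.

(** Transfers compactness of boxes from row vectors to matrices. *)
Lemma vec_mx_continuous (T : topologicalType) m n :
  continuous (vec_mx : 'rV[T]_(m * n) -> 'M[T]_(m, n)).
Proof.
move=> v B [P Pv PB].
(* Exactly one pair is coded by [k], so quantifying over pairs selects a single condition without
   decoding [k]. *)
exists (fun _ k x => forall i j, k = mxvec_index i j -> P i j x).
  move=> i0 k; case/mxvec_indexP: k => i j; rewrite ord1.
  have := Pv i j; rewrite mxE; apply: filterS => x Px i1 j1 ij.
  have [f fK _] := curry_mxvec_bij m n.
  have := fK (i1, j1) isT; rewrite /= -ij; have /= -> := fK (i, j) isT.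
  by case=> <- <-.
by move=> w Pw; apply: PB => i j; rewrite mxE; exact: Pw.
Qed.

Lemma mx_box_compact (R : realType) m n (M : R) :
  compact [set A : 'M[R]_(m, n) | forall i j, `|A i j| <= M].
Proof.
have -> : [set A : 'M[R]_(m, n) | forall i j, `|A i j| <= M] =
    vec_mx @` [set v : 'rV[R]_(m * n) | forall k, `[- M, M]%classic (v ord0 k)].
  apply/seteqP; split=> [A AM|_ [v vM <-] i j /=]; last first.
    by have := vM (mxvec_index i j); rewrite mxE /= in_itv /= ler_norml.
  exists (mxvec A); last exact: mxvecK.
  move=> k; case/mxvec_indexP: k => i j.
  by rewrite mxvecE /= in_itv /= -ler_norml.
apply: continuous_compact.
  by apply: continuous_subspaceT; exact: vec_mx_continuous.
apply: (@rV_compact _ _ (fun=> `[- M, M]%classic)) => _.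
exact: segment_compact.
Qed.

(** The columns are unit vectors, so the square of an entry is at most the sum of squares 1. *)
Lemma orthogonal_entry_le1 (R : realType) d (A : 'M[R]_d) i j :
  A^T *m A = 1%:M -> `|A i j| <= 1.
Proof.
move=> AO; have := congr1 (fun B : 'M[R]_d => B j j) AO; rewrite /= !mxE eqxx.
rewrite (bigD1 i) //= !mxE => s1.
rewrite -(@ler_sqr _ `|_|) ?nnegrE // expr1n real_normK ?num_real //.
rewrite -[leRHS]s1 expr2 lerDl; apply: sumr_ge0 => k _.
by rewrite !mxE -expr2 sqr_ge0.
Qed.

(** The orthogonal matrices form a subset of a compact box, cut out by polynomial equations in the
    entries, hence closed. *)
Lemma orthogonal_compact (R : realType) d :
  compact [set A : 'M[R]_d | A^T *m A = 1%:M].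
Proof.
have -> : [set A : 'M[R]_d | A^T *m A = 1%:M] =
     [set A : 'M[R]_d | forall i j, `|A i j| <= 1] `&`
      [set A : 'M[R]_d | A^T *m A = 1%:M].
  apply/seteqP; split=> [A AO|A []//]; split=> //= i j.
  exact: orthogonal_entry_le1.
apply: compact_closedI; first exact: mx_box_compact.
have -> : [set A : 'M[R]_d | A^T *m A = 1%:M] =
    \bigcap_(ij in [set: 'I_d * 'I_d])
      [set A : 'M[R]_d | \sum_k A k ij.1 * A k ij.2 = (ij.1 == ij.2)%:R].
  apply/seteqP; split=> [A AO [i j] _|A AO] /=.
    have := congr1 (fun B : 'M[R]_d => B i j) AO; rewrite /= !mxE => <-.
    by apply: eq_bigr => k _; rewrite mxE.
  apply/matrixP=> i j; rewrite !mxE -(AO (i, j) I) /=.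
  by apply: eq_bigr => k _; rewrite mxE.
apply: closed_bigI => -[i j] _ /=.
apply: (@preimage_closed _ _ (fun A : 'M[R]_d => \sum_k A k i * A k j)
  [set x | x = (i == j)%:R]); last exact: closed_eq.
move=> A _; move: A; apply: continuous_big => [|k _ A].
  exact: add_continuous.
exact: (cvgM (@coord_continuous R d d k i A) (@coord_continuous R d d k j A)).
Qed.

(** The topology is induced from pairs (vector, matrix), so a cluster point found in the compact
    product of a box and the orthogonal matrices is one in the isometry group. *)
Lemma euclid_compact (R : realType) d (M : R) :
  compact [set x : euclid R d | forall i j, `|(val x).1 i j| <= M].
Proof.
pose box : set ('cV[R]_d) := [set v | forall i j, `|v i j| <= M].
have K : compact (box `*` [set A : 'M[R]_d | A^T *m A = 1%:M]).
  by apply: compact_setX; [exact: mx_box_compact|exact: orthogonal_compact].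
move=> F FF FM.
have FK : (val @ F) (box `*` [set A : 'M[R]_d | A^T *m A = 1%:M]).
  apply: (@filterS _ F _ _ _ _ FM) => x xM; split=> //.
  exact/eqP/(valP x).
have [p [[pM pO] Fp]] := K (val @ F) _ FK.
have pO' : p.2^T *m p.2 == 1%:M by apply/eqP.
exists (exist _ p pO'); split=> //.
move=> A B FA [_ [[U Uo <-] Up UB]].
have [||_ [[x Ax <-] Ux]] := Fp (val @` A) U.
- by apply: (@filterS _ F _ _ _ _ FA) => x Ax; exists x.
- exact: open_nbhs_nbhs.
- by exists x; split=> //; exact: UB.
Qed.

(** Cocompactness from the translations by Z^d alone. Multiplying (v, A) on the right by the
    translation by minus the floor of A^T v gives the vector A w with w in [0, 1)^d; its entries are
    at most d, so a compact set meets every coset. *)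
Lemma uniform_subgroupP (R : realType) d (Gamma : groupClosed (euclid R d)) :
  (forall u : 'cV[int]_d, exists2 x, x \in Gamma &
    val x = (map_mx intr u, 1%:M)) ->
  uniform_subgroup Gamma.
Proof.
move=> lattice.
rewrite /uniform_subgroup.
have -> : [set: quotient_topology (coset_space Gamma)] =
    \pi_(quotient_topology (coset_space Gamma)) @`
      [set x : euclid R d | forall i j, `|(val x).1 i j| <= d%:R].
  apply/seteqP; split=> // y _.
  pose x : euclid R d := repr y; pose v := (val x).1; pose A := (val x).2.
  have [t Gt tE] := lattice (\col_i - Num.floor ((A^T *m v) i 0)).
  have AO : A^T *m A = 1%:M by exact/eqP/(valP x).
  exists (x * t)%g; last first.
    rewrite -[RHS]reprK -/x; apply: esym.
    apply/(@eqquotP _ (lcoset_equiv Gamma) (coset_space Gamma) x (x * t)%g).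
    by rewrite /= /lcoset_rel mulKg.
  move=> i j.
  pose w := A^T *m v + map_mx intr (\col_i - Num.floor ((A^T *m v) i 0)).
  have -> : (val (x * t)%g).1 = A *m w.
    by rewrite /w mulmxDr mulmxA (mulmx1C AO) mul1mx /= tE.
  rewrite mxE; apply: le_trans (ler_norm_sum _ _ _) _.
  rewrite -[leRHS]mulr1n -[d in leRHS]card_ord -sumr_const.
  apply: ler_sum => k _.
  rewrite normrM; apply: mulr_ile1 => //; first exact: orthogonal_entry_le1.
  rewrite ord1 !mxE rmorphN /=; set r := \sum_ _ _.
  by rewrite ger0_norm ?subr_ge0 ?ge_floor // lerBlDl -intrD1 ltW // floorD1_gt.
apply: continuous_compact (@euclid_compact R d d%:R).
by apply: continuous_subspaceT; exact: pi_continuous.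
Qed.

(** Entries of two elements closer than min(1, 1/c) become, after scaling the vector part by [c],
    integers at distance below 1, hence equal. *)
Lemma discrete_subgroupP (R : realType) d (Gamma : groupClosed (euclid R d))
    (c : R) :
  (forall x, x \in Gamma -> (forall i j, c * (val x).1 i j \is a Num.int) /\
    (forall i j, (val x).2 i j \is a Num.int)) -> 0 < c ->
  discrete_subgroup Gamma.
Proof.
move=> intG c0 x Gx; split; first by rewrite inE.
pose e := Num.min 1 c^-1.
have e0 : 0 < e by rewrite lt_min ltr01 invr_gt0.
exists (val @^-1` ball (val x) e).
  apply: (@initial_continuous _ _ (val : euclid R d -> _) x).
  exact: nbhsx_ballx.
apply/seteqP; split=> [y [[xy1 xy2] Gy]|_ ->]; last first.
  by split=> //; exact: ballxx.
have int_eq (s t : R) :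
    s \is a Num.int -> t \is a Num.int -> `|s - t| < 1 -> t = s.
  move=> sZ tZ st1; apply/eqP; rewrite eq_sym -subr_eq0.
  apply: contraTT st1 => st0.
  by rewrite -leNgt norm_intr_ge1 // rpredB.
have [x1 x2] := intG x Gx; have [y1 y2] := intG y Gy.
apply/val_inj; rewrite /= [LHS]surjective_pairing [RHS]surjective_pairing.
congr pair; apply/matrixP=> i j.
  apply: (mulfI (lt0r_neq0 c0)); apply: int_eq => //.
  have := xy1.2 i j; rewrite /ball /= -mulrBr normrM gtr0_norm // => h.
  rewrite -ltr_pdivlMl // mulr1; apply: lt_le_trans h _.
  by rewrite ge_min lexx orbT.
apply: int_eq => //; have := xy2.2 i j; rewrite /ball /= => h.
by apply: lt_le_trans h _; rewrite ge_min lexx.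
Qed.

End EuclideanSubgroups.

(** * Morphisms and integer powers *)

Section Quotient.
Variables (G : groupType) (N : normalClosed G).

Definition quotg_proj (x : G) : quotient_group N := \pi_(quotient_group N) x.

Lemma quotg_projM : {morph quotg_proj : x y / x * y}.
Proof. by move=> x y; exact/esym/quotg_piM. Qed.

HB.instance Definition _ := isMultiplicative.Build G (quotient_group N)
  quotg_proj quotg_projM.

Lemma quotg_proj_repr (x : quotient_group N) : quotg_proj (repr x) = x.
Proof. exact: reprK. Qed.

Lemma quotg_proj_eq1 (x : G) : x \in N -> quotg_proj x = 1.
Proof. by move=> xN; apply/esym/quotg_eqP; rewrite invg1 mul1g. Qed.

Variables (H : groupType) (f : {multiplicative G -> H}).
Hypothesis fN : forall x, x \in N -> f x = 1.

Definition quotg_lift (x : quotient_group N) : H := f (repr x).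

Lemma quotg_lift_proj x : quotg_lift (quotg_proj x) = f x.
Proof.
have /fN := quotg_reprP N x; rewrite gmulfM kernel_fV => /eqP.
by rewrite mulg_eq1 eqg_inv => /eqP.
Qed.

Lemma quotg_liftM : {morph quotg_lift : x y / x * y}.
Proof.
move=> x y; rewrite -[x]quotg_proj_repr -[y]quotg_proj_repr.
by rewrite -quotg_projM !quotg_lift_proj gmulfM.
Qed.

End Quotient.

Section IntegerPower.
Variable G : groupType.
Implicit Types x y : G.

Definition expgz x (z : int) : G :=
  match z with Posz n => x ^+ n | Negz n => x ^- n.+1 end.

Lemma expgzD1 x z : expgz x (z + 1)%R = expgz x z * x.
Proof.
case: z => [n|[|n]]; first by rewrite -PoszD addn1 /= expgSr.
  by rewrite NegzE addNr /= expg0 expg1 mulVg.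
have -> : (Negz n.+1 + 1 = Negz n)%R by lia.
by rewrite /= [in RHS]expgS invgM mulgVK.
Qed.

Lemma expgzB1 x z : expgz x (z - 1)%R = expgz x z * x^-1.
Proof. by rewrite -{2}(subrK 1%R z) expgzD1 mulgK. Qed.

Lemma expgzD x z w : expgz x (z + w)%R = expgz x z * expgz x w.
Proof.
elim/int_ind: w => [|n IH|n IH]; first by rewrite addr0 /= mulg1.
  by rewrite -addn1 PoszD addrA expgzD1 IH expgzD1 mulgA.
by rewrite -addn1 PoszD opprD addrA expgzB1 IH expgzB1 mulgA.
Qed.

Lemma commute_expgz x y z w : commute x y -> commute (expgz x z) (expgz y w).
Proof.
move=> xy; have c k : commute x (expgz y k).
  by case: k => n; [exact: commuteX | apply/commuteV/commuteX].
apply: commute_sym.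
case: z => n; first exact/commuteX/commute_sym.
exact/commuteV/commuteX/commute_sym.
Qed.

End IntegerPower.

Section Morphism.
Variables (G H : groupType) (f : {multiplicative G -> H}).

Lemma gmulf_expgn x n : f (x ^+ n) = f x ^+ n.
Proof.
by elim: n => [|n IH]; rewrite ?kernel_f1 // !expgS gmulfM IH.
Qed.

Lemma gmulf_expgz x z : f (expgz x z) = expgz (f x) z.
Proof. by case: z => n; rewrite /= ?kernel_fV gmulf_expgn. Qed.

Lemma gmulf_injective : (forall x, f x = 1 -> x = 1) -> injective f.
Proof.
move=> f1 x y fxy; apply/divg1_eq/f1.
by rewrite gmulfM kernel_fV fxy mulgV.
Qed.

End Morphism.

(** * Groups generated by a braid pair *)

Lemma conjg_commute (G : groupType) (x y : G) : commute x y -> x ^ y = x.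
Proof. by move=> xy; rewrite conjgE xy mulKg. Qed.

Section BraidPair.
Variables (G : groupType) (a b : G).
Hypothesis braid : a * b * a = b * a * b.
(** Generation of [G] by [a] and [b], as an induction over words read from the left. *)
Hypothesis gen_ind : forall P : G -> Prop, P 1 ->
  (forall x, P x -> P (a * x)) -> (forall x, P x -> P (b * x)) ->
  (forall x, P x -> P (a^-1 * x)) -> (forall x, P x -> P (b^-1 * x)) ->
  forall x, P x.

Definition twist : G := (a * b) ^+ 3.

(** Indices above 3 repeat the last cusp, so statements about all [i] need no bound. *)
Definition cusp (i : nat) : G :=
  match i with
  | 0 => a ^+ 3
  | 1 => b * a ^+ 3 * b^-1
  | 2 => b ^+ 3
  | _ => a * b ^+ 3 * a^-1
  end.

(* [cusp_rep j] conjugates [cusp 0] to [cusp j], up to conjugation by cusps. *)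
Definition cusp_rep (j : nat) : G :=
  match j with 0 => 1 | 1 => b | 2 => a * b | _ => a^-1 * b end.

Definition cusp_group : set G :=
  generated [set x | x = twist \/ exists i, x = cusp i].

Lemma braidA z : a * (b * (a * z)) = b * (a * (b * z)).
Proof. by have := congr1 (fun x => x * z) braid; rewrite /= -!mulgA. Qed.

Lemma conj_b_a : b^-1 * a * b = a * b * a^-1.
Proof.
by apply: (mulgI b); apply: (mulIg a); rewrite !mulgA mulgV mul1g mulgVK -braid.
Qed.

Lemma conj_a_b : a^-1 * b * a = b * a * b^-1.
Proof.
by apply: (mulgI a); apply: (mulIg b); rewrite !mulgA mulgV mul1g mulgVK braid.
Qed.

(** Cubing [conj_b_a] presents this cusp as a conjugate of either cube, so that both generators can
    act on it. *)
Lemma conj_b_aX : b^-1 * a ^+ 3 * b = cusp 3.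
Proof.
rewrite -mulgA -conjgE conjXg conjgE mulgA conj_b_a.
have -> : a * b * a^-1 = b ^ a^-1 by rewrite conjgE invgK mulgA.
by rewrite -conjXg conjgE invgK mulgA.
Qed.

Lemma conj_a_bX : a^-1 * b ^+ 3 * a = cusp 1.
Proof.
rewrite -mulgA -conjgE conjXg conjgE mulgA conj_a_b.
have -> : b * a * b^-1 = a ^ b^-1 by rewrite conjgE invgK mulgA.
by rewrite -conjXg conjgE invgK mulgA.
Qed.

Lemma twistE : twist = a * b * a * (a * b * a).
Proof.
transitivity (a * b * a * (b * a * b)); last by rewrite -braid.
by rewrite /twist !expgS expg0 mulg1 !mulgA.
Qed.

(** The half twist exchanges the two generators, so its square, the full twist, commutes with
    both. *)
Lemma half_twist_a : a * b * a * a = b * (a * b * a).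
Proof. by rewrite {1}braid -!mulgA. Qed.

Lemma half_twist_b : a * b * a * b = a * (a * b * a).
Proof. by rewrite -2!mulgA [b * (a * b)]mulgA -braid. Qed.

Lemma twist_a : twist * a = a * twist.
Proof.
by rewrite twistE -(mulgA (a * b * a)) half_twist_a mulgA half_twist_b -mulgA.
Qed.

Lemma twist_b : twist * b = b * twist.
Proof.
by rewrite twistE -(mulgA (a * b * a)) half_twist_b mulgA half_twist_a -mulgA.
Qed.

Lemma twist_conj g : twist ^ g = twist.
Proof.
elim/gen_ind: g => [|x IH|x IH|x IH|x IH]; first exact: conjg1.
- by rewrite conjgM (@conjg_commute _ _ a) //; exact: twist_a.
- by rewrite conjgM (@conjg_commute _ _ b) //; exact: twist_b.
- by rewrite conjgM (@conjg_commute _ _ a^-1) //; apply/commuteV/twist_a.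
- by rewrite conjgM (@conjg_commute _ _ b^-1) //; apply/commuteV/twist_b.
Qed.

Lemma twistC g : twist * g = g * twist.
Proof. by rewrite conjgC twist_conj. Qed.

(* With x = ab one has x a = b x and x b = (a b a^-1) x, so the product
   (a^2 x)^3 of the four cusps equals a^2 b^2 (a b a^-1)^2 x^3. *)
Lemma twist_cusps : twist ^+ 2 = cusp 0 * cusp 1 * cusp 2 * cusp 3.
Proof.
pose x := a * b; pose d := a * b * a^-1.
have xa : x * a = b * x by rewrite /x braid !mulgA.
have xb : x * b = d * x by rewrite /x /d !mulgA mulgVK.
have xaa z : x * (a ^+ 2 * z) = b ^+ 2 * (x * z).
  by rewrite !expg2 !mulgA xa -(mulgA b) xa !mulgA.
have xbb z : x * (b ^+ 2 * z) = d ^+ 2 * (x * z).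
  by rewrite !expg2 !mulgA xb -(mulgA d) xb !mulgA.
have -> : cusp 0 * cusp 1 * cusp 2 * cusp 3 =
    a ^+ 2 * (x * (a ^+ 2 * (x * (a ^+ 2 * x)))).
  rewrite -[cusp 3]conj_b_aX /= /x !expgS !expg0 !mulg1 !mulgA.
  by rewrite mulgVK mulgK.
rewrite !xaa xbb.
have -> : x * (x * x) = twist by rewrite /twist !expgS expg0 mulg1.
suff key : a ^+ 2 * (b ^+ 2 * d ^+ 2) = twist.
  by rewrite [RHS]mulgA [RHS]mulgA -(mulgA (a ^+ 2)) key expg2.
have -> : d ^+ 2 = a * b ^+ 2 * a^-1.
  by rewrite /d !expg2 !mulgA mulgVK.
(* Multiplying by [a] on the right cancels the inverse at the end of [d ^+ 2]; what remains follows
   from one braid move. *)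
apply: (mulIg a); rewrite twist_a !mulgA mulgVK.
rewrite /twist !expgS !expg0 !mulg1 -!mulgA; do 2!congr (_ * _).
by rewrite braidA.
Qed.

Lemma cusp_group_twist : cusp_group twist.
Proof. by apply: generated_sub; left. Qed.

Lemma cusp_group_cusp i : cusp_group (cusp i).
Proof. by apply: generated_sub; right; exists i. Qed.

(** Normality of N: each generator permutes the cusps up to conjugation by cusps, and fixes the
    twist. *)
Lemma cusp_groupJ g n : cusp_group n -> cusp_group (n ^ g).
Proof.
have E0 : cusp_group (cusp 0) by exact: cusp_group_cusp.
have E1 : cusp_group (cusp 1) by exact: cusp_group_cusp.
have E2 : cusp_group (cusp 2) by exact: cusp_group_cusp.
have E3 : cusp_group (cusp 3) by exact: cusp_group_cusp.
have stable x y : (forall i, cusp_group (cusp i ^ y)) -> cusp_group x ->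
    cusp_group (x ^ y).
  move=> ey; elim=> {x} [|x [->|[i ->]]|u v _ IHu _ IHv|u _ IHu].
  - by rewrite conj1g; exact: generated1.
  - by rewrite twist_conj; exact: cusp_group_twist.
  - exact: ey.
  - by rewrite conjMg; exact: generatedM.
  - by rewrite conjVg; exact: generatedV.
have conj_in u v : cusp_group u -> cusp_group v -> cusp_group (u ^ v).
  by move=> hu hv; rewrite conjgE; do ?[apply: generatedM | apply: generatedV].
have JV (u v : G) : v * u * v^-1 = u ^ v^-1 by rewrite conjgE invgK mulgA.
have ca i : cusp_group (cusp i ^ a).
  case: i => [|[|[|i]]] /=.
  - by rewrite conjg_commute //; apply/commute_sym/commuteX.
  (* Both sides are [b ^+ 3] conjugated by [a ^+ 2], since cusps 1 and 3 are its conjugates by [a]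
     and by [a^-1]. *)
  - have -> : (b * a ^+ 3 * b^-1) ^ a = cusp 3 ^ cusp 0.
      rewrite -[b * _ * _]conj_a_bX.
      rewrite -mulgA -conjgE -conjgM -expg2 /= JV -conjgM.
      by rewrite (expgS a 2) mulKg.
    exact: conj_in.
  - by rewrite conjgE mulgA conj_a_bX.
  - by rewrite JV conjgKV.
have cb i : cusp_group (cusp i ^ b).
  case: i => [|[|[|i]]] /=.
  - by rewrite conjgE mulgA conj_b_aX.
  - by rewrite JV conjgKV.
  - by rewrite conjg_commute //; apply/commute_sym/commuteX.
  - have -> : (a * b ^+ 3 * a^-1) ^ b = cusp 1 ^ cusp 2.
      rewrite -[a * _ * _]conj_b_aX.
      rewrite -mulgA -conjgE -conjgM -expg2 /= JV -conjgM.
      by rewrite (expgS b 2) mulKg.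
    exact: conj_in.
(* As [a ^+ 3] lies in N, conjugation by [a^-1] reduces to conjugating twice by [a] and once by an
   element of N. *)
have caV i : cusp_group (cusp i ^ a^-1).
  have -> : a^-1 = a ^+ 2 * (cusp 0)^-1.
    by rewrite /= expgSr invgM mulKVg.
  rewrite expg2 !conjgM; apply: conj_in; last exact: generatedV.
  by apply: stable; last exact: ca.
have cbV i : cusp_group (cusp i ^ b^-1).
  have -> : b^-1 = b ^+ 2 * (cusp 2)^-1.
    by rewrite /= expgSr invgM mulKVg.
  rewrite expg2 !conjgM; apply: conj_in; last exact: generatedV.
  by apply: stable; last exact: cb.
elim/gen_ind: g n => [|x IH|x IH|x IH|x IH] n hn; first by rewrite conjg1.
- by rewrite conjgM; apply/IH/stable.
- by rewrite conjgM; apply/IH/stable.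
- by rewrite conjgM; apply/IH/stable.
- by rewrite conjgM; apply/IH/stable.
Qed.

(* The preimage of the stabilizer of the cusp 0 in the alternating group. *)
Definition cusp_stab : set G :=
  [set h | exists (m : nat) n, cusp_group n /\ h = a ^+ m * n].

Lemma cusp_stabM h k : cusp_stab h -> cusp_stab k -> cusp_stab (h * k).
Proof.
move=> [m [n [Nn ->]]] [m' [n' [Nn' ->]]].
exists (m + m')%N, (n ^ (a ^+ m') * n'); split.
  by apply: generatedM => //; exact: cusp_groupJ.
by rewrite expgnDr mulgA -(mulgA _ n) (conjgC n) [in LHS]mulgA -mulgA.
Qed.

Lemma cusp_stab_group n : cusp_group n -> cusp_stab n.
Proof. by move=> Nn; exists 0%N, n; rewrite expg0 mul1g. Qed.

Lemma cusp_stab_a : cusp_stab a.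
Proof. by exists 1%N, 1; split; [exact: generated1|rewrite mulg1 expg1]. Qed.

Lemma cusp_stab_aV : cusp_stab a^-1.
Proof.
exists 2%N, (cusp 0)^-1; split; first exact/generatedV/cusp_group_cusp.
by rewrite /= expgSr invgM mulKVg.
Qed.

(** The union of the four cosets [cusp_rep j] times [cusp_stab] contains 1 and is stable under left
    multiplication by the generators, which permute the cusps; hence it is the whole group. *)
Lemma cusp_decomposition x : exists j m n,
  [/\ (j < 4)%N, (m < 3)%N, cusp_group n & x = cusp_rep j * a ^+ m * n].
Proof.
(* The exponent of [a] may be arbitrary: its multiple of 3 contributes a power of [cusp 0], absorbed
   into [n]. *)
suff [j [h [lt_j4 [m [n [Nn hE]]] ->]]] :
    exists j h, [/\ (j < 4)%N, cusp_stab h & x = cusp_rep j * h].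
  exists j, (m %% 3)%N, ((a ^+ 3) ^+ (m %/ 3) * n).
  split=> //; first by rewrite ltn_mod.
    apply: generatedM => //; elim: (m %/ 3)%N => [|k IH].
      by rewrite expg0; exact: generated1.
    by rewrite expgS; apply: generatedM => //; exact: (cusp_group_cusp 0).
  rewrite hE {1}(divn_eq m 3) addnC mulnC expgnDr expgnA !mulgA.
  by [].
pose S x := exists j h, [/\ (j < 4)%N, cusp_stab h & x = cusp_rep j * h].
rewrite -/(S x).
have SN n y : cusp_group n -> S y -> S (n * y).
  move=> Nn [j [h [lt_j4 Hh ->]]]; exists j, (n ^ cusp_rep j * h).
  split=> //; last by rewrite mulgA (conjgC n) -mulgA.
  by apply: cusp_stabM => //; apply/cusp_stab_group/cusp_groupJ.
have twisty h : cusp_stab h ->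
    cusp_stab (a^-1 * (b ^- 3 * (twist * (a^-1 * h)))).
  move=> Hh; apply: cusp_stabM; first exact: cusp_stab_aV.
  apply: cusp_stabM; first exact/cusp_stab_group/generatedV/(cusp_group_cusp 2).
  apply: cusp_stabM; first exact/cusp_stab_group/cusp_group_twist.
  by apply: cusp_stabM => //; exact: cusp_stab_aV.
(* This brings [b * cusp_rep 3] into the stabilizer of cusp 0, and, combined with [conj_a_b],
   [b * cusp_rep 1] into the coset of [cusp_rep 3]. *)
have bab : b * a^-1 * b = a^-1 * (b ^- 3 * (twist * a^-1)).
  apply: (mulgI a); apply: (mulIg a); rewrite mulVKg -(mulgA (b ^- 3)) mulgVK.
  apply: (mulgI (b ^+ 3)); rewrite mulVKg twistE {2}braid.
  have -> : a * b * a * (b * a * b) = b * b * (b * (a * b * a^-1) * b * a).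
    rewrite -conj_b_a -(mulgA b^-1) mulVKg -!mulgA braidA; congr (_ * _).
    by rewrite -braidA; do 2!congr (_ * _); rewrite !mulgA braid.
  by rewrite !expgS expg0 mulg1 !mulgA.
have Sa y : S y -> S (a * y).
  move=> [[|[|[|[|j]]]] [h [lt_j Hh ->]]] //.
  - exists 0%N, (a * h); split=> //; last by rewrite !mul1g.
    by apply: cusp_stabM => //; exact: cusp_stab_a.
  - by exists 2%N, h; rewrite /= !mulgA.
  - suff -> : a * (cusp_rep 2 * h) = cusp 0 * (cusp_rep 3 * h).
      by apply: SN; [exact: cusp_group_cusp|exists 3%N, h].
    by rewrite /= expgSr expg2 -!mulgA mulKVg.
  - by exists 1%N, h; rewrite /= -mulgA mulKVg.
have Sb y : S y -> S (b * y).
  move=> [[|[|[|[|j]]]] [h [lt_j Hh ->]]] //.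
  - by exists 1%N, h; rewrite mul1g.
  - exists 3%N, (a * (a^-1 * (b ^- 3 * (twist * (a^-1 * h))))).
    split=> //; first by apply/cusp_stabM/twisty => //; exact: cusp_stab_a.
    have -> : b ^- 3 * (twist * (a^-1 * h)) = a * (b * a^-1 * b * h).
      by rewrite bab -!mulgA mulVKg.
    by rewrite mulKVg /= !mulgA conj_a_b mulgVK mulgK.
  - exists 2%N, (a * h); split=> //=.
      by apply: cusp_stabM => //; exact: cusp_stab_a.
    by rewrite !mulgA braid.
  - exists 0%N, (a^-1 * (b ^- 3 * (twist * (a^-1 * h)))).
    split=> //; first exact: twisty.
    by rewrite mul1g !mulgA bab !mulgA.
have SaV y : S y -> S (a^-1 * y).
  move=> Sy; have -> : a^-1 = (cusp 0)^-1 * (a * a).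
    by rewrite -expg2 /= (expgSr a 2) invgM mulgVK.
  rewrite -!mulgA; apply: SN; first exact/generatedV/cusp_group_cusp.
  exact/Sa/Sa.
have SbV y : S y -> S (b^-1 * y).
  move=> Sy; have -> : b^-1 = (cusp 2)^-1 * (b * b).
    by rewrite -expg2 /= (expgSr b 2) invgM mulgVK.
  rewrite -!mulgA; apply: SN; first exact/generatedV/cusp_group_cusp.
  exact/Sb/Sb.
apply: (gen_ind (P := S)) => //; exists 0%N, 1.
split=> //; last by rewrite mulg1.
exact/cusp_stab_group/generated1.
Qed.

End BraidPair.

(** * The reduced Burau representation modulo 3 *)

Definition sigma (b : bool) : B3 := presented_gen braid3_relation b.

Lemma presented_genV (X : choiceType) r (x : X) :
  (presented_gen r x)^-1 = \pi_(presented r) [:: (x, true)].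
Proof. exact: presented_piV. Qed.

Lemma sigma_braid :
  sigma false * sigma true * sigma false =
  sigma true * sigma false * sigma true.
Proof.
rewrite /sigma /presented_gen -[_ * _]/(presented_mul _ _).
rewrite -[in RHS]/(presented_mul _ _) -![_ * _]/(presented_mul _ _).
rewrite !presented_piM; apply/presented_eqP.
exact: word_eq_relation.
Qed.

Lemma sigma_ind (P : B3 -> Prop) : P 1 ->
  (forall x, P x -> P (sigma false * x)) ->
  (forall x, P x -> P (sigma true * x)) ->
  (forall x, P x -> P ((sigma false)^-1 * x)) ->
  (forall x, P x -> P ((sigma true)^-1 * x)) -> forall x, P x.
Proof.
move=> P1 Pa Pb PaV PbV x; rewrite -[x]reprK.
elim: (repr x) => [|[c v] w IH]; first exact: P1.
have -> : \pi_B3 ((c, v) :: w) =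
    (if v then (sigma c)^-1 else sigma c) * \pi_B3 w.
  apply: esym; case: v; last exact: presented_piM.
  by rewrite presented_genV; exact: presented_piM.
by case: v; case: c; auto.
Qed.

Lemma mx2M (F : comNzRingType) (a b c d a' b' c' d' : F) :
  (mx2 a b c d *m mx2 a' b' c' d' =
  mx2 (a * a' + b * c') (a * b' + b * d')
      (c * a' + d * c') (c * b' + d * d'))%R.
Proof.
by apply/matrixP=> i j; rewrite !(mxE, big_ord_recl, big_ord0) /= addr0;
  case: ifP; case: ifP.
Qed.

Lemma mx2_1 (F : comNzRingType) : (1%:M = mx2 1 0 0 1 :> 'M[F]_2)%R.
Proof.
by apply/matrixP=> i j; rewrite !mxE;
  case: i => [[|[|//]] ?]; case: j => [[|[|//]] ?].
Qed.

Definition rho3_mx (x : B3) : 'M['F_3]_2 := GLval (sgval (rho3 x)).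

Lemma rho3_mxM x y : rho3_mx (x * y) = (rho3_mx x *m rho3_mx y)%R.
Proof. by rewrite /rho3_mx gmulfM sgvalM ?inE // GL_MxE. Qed.

Lemma rho3_mx1 : rho3_mx 1 = 1%:M%R.
Proof. by rewrite /rho3_mx kernel_f1. Qed.

Lemma rho3_mx_inj x y : rho3_mx x = rho3_mx y -> rho3 x = rho3 y.
Proof. by move=> xy; do 2!apply/val_inj. Qed.

Lemma rho3_mxV x : (rho3_mx x^-1%g *m rho3_mx x = 1%:M)%R.
Proof. by rewrite -rho3_mxM mulVg rho3_mx1. Qed.

Lemma rho3_mx_sigma b : rho3_mx (sigma b) = sigma_mx b.
Proof. exact: rho3_gen_image. Qed.

Lemma rho3_mx_sigmaX b n :
  rho3_mx (sigma b ^+ n) =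
  (if b then mx2 1 0 (- n%:R) 1 else mx2 1 n%:R 0 1)%R.
Proof.
elim: n => [|n IH]; first by rewrite expg0 rho3_mx1 oppr0 mx2_1; case: b.
rewrite expgS rho3_mxM IH rho3_mx_sigma mulrS; case: b {IH}; rewrite mx2M;
  by congr mx2; ring.
Qed.

Lemma rho3_mx_sigmaV b :
  rho3_mx (sigma b)^-1 = (if b then mx2 1 0 1 1 else mx2 1 (-1) 0 1)%R.
Proof.
have := rho3_mxV (sigma b); rewrite rho3_mx_sigma => H.
rewrite -[LHS]mulmx1.
have <- : (sigma_mx b *m (if b then mx2 1 0 1 1 else mx2 1 (-1) 0 1) = 1%:M)%R.
  by case: b {H}; rewrite mx2M mx2_1; congr mx2; ring.
by rewrite mulmxA H mul1mx.
Qed.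

Definition rho3_central (x : B3) := sgval (rho3 x) \in 'Z(Sp2_F3_group).

Lemma rho3_central_comm x y :
  rho3_central x -> (rho3_mx x *m rho3_mx y = rho3_mx y *m rho3_mx x)%R.
Proof.
move=> /centerP[_ xC]; rewrite /rho3_mx.
have E (g h : {'GL_2['F_3]}) : (GLval g *m GLval h)%R = GLval (g * h).
  by rewrite GL_MxE.
by rewrite !E (xC (sgval (rho3 y)) (subgP _)).
Qed.

Lemma rho3_central_scalar x c : rho3_mx x = c%:M%R -> rho3_central x.
Proof.
move=> xc; apply/centerP; split=> [|g _]; first exact: subgP.
apply/val_inj; change (GLval (sgval (rho3 x) * g) = GLval (g * sgval (rho3 x))).
by rewrite !GL_MxE -/(rho3_mx x) xc scalar_mxC.
Qed.

Lemma rho3_central1 : rho3_central 1.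
Proof. by apply: (rho3_central_scalar (c := 1%R)); rewrite rho3_mx1. Qed.

Lemma rho3_centralM x y :
  rho3_central x -> rho3_central y -> rho3_central (x * y).
Proof. by rewrite /rho3_central gmulfM sgvalM ?in_setT //; exact: groupM. Qed.

Lemma rho3_centralV x : rho3_central x -> rho3_central x^-1.
Proof.
rewrite /rho3_central kernel_fV => xZ.
by rewrite (morphV (sgval_morphism _)) ?in_setT // groupV.
Qed.

Lemma rho3_sigma_cube b : rho3 (sigma b ^+ 3) = 1.
Proof.
rewrite -(kernel_f1 rho3); apply: rho3_mx_inj.
rewrite rho3_mx_sigmaX rho3_mx1 mx2_1; case: b; congr mx2; exact/val_inj.
Qed.

Local Notation cusp3 := (cusp (sigma false) (sigma true)).
Local Notation cusp_rep3 := (cusp_rep (sigma false) (sigma true)).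
Local Notation cusp_group3 := (cusp_group (sigma false) (sigma true)).
Local Notation twist3 := (twist (sigma false) (sigma true)).

Lemma cusp_level3 i : cusp3 i \in B3_level3.
Proof.
have cube b : sigma b ^+ 3 \in B3_level3.
  by rewrite unfold_in rho3_sigma_cube.
have J b c : sigma b * sigma c ^+ 3 * (sigma b)^-1 \in B3_level3.
  rewrite -{1}(invgK (sigma b)) -mulgA -conjgE.
  exact: kernelJ.
by case: i => [|[|[|i]]] /=; rewrite ?J ?cube.
Qed.

Lemma rho3_mx_twist : rho3_mx twist3 = (- 1)%:M%R.
Proof.
rewrite /twist !expgS expg0 mulg1 !rho3_mxM !rho3_mx_sigma !mx2M.
by apply/matrixP=> i j; rewrite !mxE;
  case: i => [[|[|//]] ?]; case: j => [[|[|//]] ?]; apply/val_inj.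
Qed.

Lemma cusp_group_central n : cusp_group3 n -> rho3_central n.
Proof.
elim=> {n} [|n [->|[i ->]]|x y _ IHx _ IHy|x _ IHx].
- exact: rho3_central1.
- exact/rho3_central_scalar/rho3_mx_twist.
- apply: (rho3_central_scalar (c := 1%R)).
  have /eqP := cusp_level3 i.
  by rewrite /rho3_mx => ->; rewrite GL_1E.
- exact: rho3_centralM.
- exact: rho3_centralV.
Qed.

(** Each of the eleven other representatives fails to commute with the image of a generator, already
    in an entry of the first row. *)
Lemma rho3_central_rep j m : (j < 4)%N -> (m < 3)%N ->
  rho3_central (cusp_rep3 j * sigma false ^+ m) -> j = 0%N /\ m = 0%N.
Proof.
move=> lt_j4 lt_m3 xC.
have := rho3_central_comm (sigma true) xC.
have := rho3_central_comm (sigma false) xC.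
rewrite rho3_mxM rho3_mx_sigmaX !rho3_mx_sigma.
move: j m lt_j4 lt_m3 {xC} => [|[|[|[|//]]]] [|[|[|//]]] _ _ //=;
  rewrite ?rho3_mxM ?rho3_mx1 ?rho3_mx_sigmaV ?rho3_mx_sigma ?mx2_1 !mx2M.
all: move=> /matrixP E /matrixP E'; exfalso.
all: first
  [ by have /eqP := E 0%R 0%R; rewrite !mxE; vm_compute
  | by have /eqP := E 0%R 1%R; rewrite !mxE; vm_compute
  | by have /eqP := E' 0%R 0%R; rewrite !mxE; vm_compute
  | by have /eqP := E' 0%R 1%R; rewrite !mxE; vm_compute ].
Qed.

Lemma mx2E (F : Type) (A : 'M[F]_2) :
  A = mx2 (A 0%R 0%R) (A 0%R 1%R) (A 1%R 0%R) (A 1%R 1%R).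
Proof.
by apply/matrixP=> i j; rewrite !mxE; case: i => [[|[|//]] ?];
  case: j => [[|[|//]] ?] /=; congr (A _ _); apply/val_inj.
Qed.

Lemma det_mx2 (F : comNzRingType) (a b c d : F) :
  (\det (mx2 a b c d) = a * d - b * c)%R.
Proof.
rewrite (expand_det_row _ 0%R) !big_ord_recl big_ord0 /cofactor.
by rewrite !det_mx11 !mxE /= expr0 expr1; ring.
Qed.

(** Row reduction: the images of the generators are elementary matrices, and these generate
    SL_2(F_3). *)
Lemma rho3_surj (g : {'GL_2['F_3]}) :
  g \in Sp2_F3_group -> exists x, sgval (rho3 x) = g.
Proof.
have lower (p q r s : 'F_3) : r != 0%R -> (p * s - q * r = 1)%R ->
    exists x, rho3_mx x = mx2 p q r s.
  move=> r0 det1.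
  (* The middle factor creates the lower left entry [r], and the outer ones adjust the diagonal;
     elements of F_3 are read as natural exponents. *)
  exists (sigma false ^+ ((p - 1) / r)%R * sigma true ^+ (- r)%R *
    sigma false ^+ ((s - 1) / r)%R).
  rewrite !rho3_mxM !rho3_mx_sigmaX !natr_Zp !mx2M.
  have -> : q = ((p * s - 1) / r)%R by rewrite -det1; field.
  by congr mx2; field.
have rho3_mx_surj (A : 'M['F_3]_2) : (\det A = 1)%R -> exists x, rho3_mx x = A.
  rewrite (mx2E A) det_mx2.
  move: (A 0 0)%R (A 0 1)%R (A 1 0)%R (A 1 1)%R => p q r s.
  have [-> | r0] := eqVneq r 0%R; last exact: lower.
  rewrite mulr0 subr0 => ps1.
  have s0 : s != 0%R.
    by apply/eqP => s0; move/eqP: ps1; rewrite s0 mulr0 eq_sym oner_eq0.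
  (* Adding the second column to the first makes the lower left entry [s], which is nonzero;
     [sigma true] undoes this. *)
  have [|x xE] := lower (p + q)%R q s s s0; first by rewrite -ps1; ring.
  exists (x * sigma true).
  by rewrite rho3_mxM xE rho3_mx_sigma mx2M; congr mx2; ring.
rewrite /= Sp2_F3_det => /eqP/rho3_mx_surj[x xg]; exists x.
exact/val_inj.
Qed.

(** * Affine monomial transformations of R^4 *)

(* The pair [(w, f)] encodes the isometry v |-> w/6 + (v_(f 0), ..., v_(f 3)) of
   R^4; the entries of [f] must be smaller than 4. *)
Definition aff := (seq int * seq nat)%type.

Definition aff_one : aff := (nseq 4 0%R, iota 0 4).

Definition aff_mul (m m' : aff) : aff :=
  ([seq (m.1`_i + m'.1`_(nth 0%N m.2 i))%R | i <- iota 0 4],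
   [seq nth 0%N m'.2 (nth 0%N m.2 i) | i <- iota 0 4]).

Section Affine.
Variable R : realType.

Definition aff_vec (w : seq int) : 'cV[R]_4 := (\col_i ((w`_i)%:~R / 6%:R))%R.

Definition aff_mx (f : seq nat) : 'M[R]_4 :=
  (\matrix_(i, j) (nth 0%N f i == j)%:R)%R.

(** Reduces identities between isometries to computations on lists of integers. *)
Definition is_aff (x : euclid R 4) (m : aff) : Prop :=
  all (fun k => k < 4)%N m.2 /\ val x = (aff_vec m.1, aff_mx m.2).

Lemma is_aff_inj x y m : is_aff x m -> is_aff y m -> x = y.
Proof. by move=> [_ xm] [_ ym]; apply/val_inj; rewrite /= xm ym. Qed.

Lemma aff_index (f : seq nat) i :
  all (fun k => k < 4)%N f -> (nth 0%N f i < 4)%N.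
Proof.
move=> /(all_nthP 0%N) fP.
by case: (ltnP i (size f)) => [/fP//|/(nth_default 0%N) ->].
Qed.

Lemma is_aff1 : is_aff 1 aff_one.
Proof.
split=> //; congr pair; apply/matrixP => i j; rewrite !mxE.
  by rewrite nth_nseq if_same mul0r.
by rewrite nth_iota.
Qed.

Lemma aff_mx_mul f n (A : 'M[R]_(4, n)) (i : 'I_4) j
    (lt_fi : (nth 0%N f i < 4)%N) :
  ((aff_mx f *m A) i j = A (Ordinal lt_fi) j)%R.
Proof.
rewrite mxE (bigD1 (Ordinal lt_fi)) //= mxE eqxx mul1r big1 ?addr0 // => k nk.
by rewrite mxE -val_eqE /= eq_sym in nk *; rewrite (negPf nk) mul0r.
Qed.

Lemma aff_mx_mulE m m' : all (fun k => k < 4)%N m.2 ->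
  aff_mx (aff_mul m m').2 = (aff_mx m.2 *m aff_mx m'.2)%R.
Proof.
move=> fP; apply/matrixP=> i j; rewrite aff_mx_mul; first exact: aff_index.
by move=> lt_fi; rewrite !mxE (nth_map 0%N) ?size_iota // nth_iota.
Qed.

Lemma aff_vec_mulE m m' : all (fun k => k < 4)%N m.2 ->
  aff_vec (aff_mul m m').1 = (aff_vec m.1 + aff_mx m.2 *m aff_vec m'.1)%R.
Proof.
move=> fP; apply/matrixP=> i j; rewrite [RHS]mxE aff_mx_mul.
  exact: aff_index.
move=> lt_fi; rewrite !mxE (nth_map 0%N) ?size_iota // nth_iota // add0n.
by rewrite rmorphD mulrDl.
Qed.

Lemma is_affM x y m m' :
  is_aff x m -> is_aff y m' -> is_aff (x * y) (aff_mul m m').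
Proof.
move=> [fP xm] [fP' ym]; split.
  by apply/allP=> k /mapP[i _ ->]; exact: aff_index.
have -> : val (x * y) = ((val x).1 + (val x).2 *m (val y).1,
  (val x).2 *m (val y).2)%R by [].
by rewrite xm ym aff_vec_mulE // aff_mx_mulE.
Qed.

(** An inverse code is guessed and checked by one multiplication, instead of being computed by
    transposition. *)
Lemma is_affV x m m' : is_aff x m -> all (fun k => k < 4)%N m'.2 ->
  aff_mul m m' = aff_one -> is_aff x^-1 m'.
Proof.
move=> [fP xm] fP' mm'; split=> //.
have -> : val x^-1 = (- ((val x).2^T *m (val x).1), (val x).2^T)%R by [].
have := valP x; rewrite xm /= => /eqP xO.
have [_ [/esym v0 /esym A1]] := is_aff1.
have := aff_mx_mulE m' fP; rewrite mm' A1 => mx_mm'.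
have := aff_vec_mulE m' fP; rewrite mm' v0 => vec_mm'.
congr pair; last by rewrite -[RHS]mul1mx -xO -mulmxA -mx_mm' mulmx1.
apply/eqP; rewrite eqr_oppLR -addr_eq0.
rewrite -[X in (_ + X)%R]mul1mx -xO -mulmxA -mulmxDr.
by rewrite -vec_mm' mulmx0.
Qed.

Lemma is_aff_eq x m m' : is_aff x m -> m = m' -> is_aff x m'.
Proof. by move=> xm <-. Qed.

(** Such a list is a permutation of the four indices, so [aff_mx f] is a permutation matrix. *)
Lemma aff_orthogonal f : all (fun k => k < 4)%N f -> size f = 4%N -> uniq f ->
  ((aff_mx f)^T *m aff_mx f == 1%:M)%R.
Proof.
move=> fP sf uf; apply/eqP/matrixP=> i j; rewrite !mxE.
have fi : (index (i : nat) f < 4)%N.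
  suff: (i : nat) \in f by rewrite -index_mem sf.
  have [||_ ->] := uniq_min_size (s1 := f) (s2 := iota 0 4) uf.
  - by move=> k /(allP fP); rewrite mem_iota add0n.
  - by rewrite sf.
  - by rewrite mem_iota add0n /=.
rewrite (bigD1 (Ordinal fi)) //= big1 => [|k nk].
  rewrite !mxE /= nth_index -?index_mem ?sf // eqxx mul1r addr0.
  by rewrite -val_eqE.
rewrite !mxE; case: eqP => [fk|_]; last by rewrite mul0r.
case/eqP: nk; apply/val_inj => /=.
by rewrite -fk index_uniq // sf.
Qed.

(* Up to translations, the entry sums are forced by the cubes being the
   translations by basis vectors, and the other entries of the second vector
   solve the braid relation. *)
Definition aff_gen (b : bool) : aff :=
  if b then ([:: 0; -1; 2; 1]%R, [:: 3; 0; 2; 1]%N)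
  else ([:: 2; 0; 0; 0]%R, [:: 0; 3; 1; 2]%N).

Lemma aff_gen_orthogonal b :
  ((aff_mx (aff_gen b).2)^T *m aff_mx (aff_gen b).2 == 1%:M)%R.
Proof. by apply: aff_orthogonal; case: b. Qed.

Definition euclid_gen (b : bool) : euclid R 4 :=
  exist _ (aff_vec (aff_gen b).1, aff_mx (aff_gen b).2) (aff_gen_orthogonal b).

Lemma is_aff_gen b : is_aff (euclid_gen b) (aff_gen b).
Proof. by split; case: b. Qed.

Definition aff_genV (b : bool) : aff :=
  if b then ([:: 1; -1; -2; 0]%R, [:: 1; 3; 2; 0]%N)
  else ([:: -2; 0; 0; 0]%R, [:: 0; 2; 3; 1]%N).

Lemma is_aff_genV b : is_aff (euclid_gen b)^-1 (aff_genV b).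
Proof. by apply: is_affV (is_aff_gen b) _ _; case: b. Qed.

Lemma euclid_gen_braid :
  euclid_gen false * euclid_gen true * euclid_gen false =
  euclid_gen true * euclid_gen false * euclid_gen true.
Proof.
have a := is_aff_gen false; have b := is_aff_gen true.
by apply: is_aff_inj (is_affM (is_affM a b) a) (is_affM (is_affM b a) b).
Qed.

End Affine.

Lemma derived_gmulf1 (G H : groupType) (N : normalClosed G)
    (f : {multiplicative G -> H}) :
  (forall x y, x \in N -> y \in N -> commute (f x) (f y)) ->
  forall x, x \in derived N -> f x = 1.
Proof.
move=> fN x; rewrite inE.
elim=> {x} [|x [a Na [b Nb <-]]|x y _ IHx _ IHy|x _ IHx].
- exact: kernel_f1.
- by rewrite commgEl conjgE !gmulfM !kernel_fV (fN a b) // mulKg mulVg.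
- by rewrite gmulfM IHx IHy mulg1.
- by rewrite kernel_fV IHx invg1.
Qed.

(** * The affine action of B_3 on R^4 and its descent modulo [K, K] *)

Section AffineAction.
Variable R : realType.
Implicit Types (x y : euclid R 4) (m : aff).

(** Stated index by index because the isometry does not see list entries past the fourth. *)
Lemma is_aff_uniq x m m' : is_aff x m -> is_aff x m' ->
  forall i, (i < 4)%N ->
  nth 0%R m.1 i = nth 0%R m'.1 i /\ nth 0%N m.2 i = nth 0%N m'.2 i.
Proof.
move=> [fP xm] [fP' xm'] i lt_i4.
have [/matrixP vE /matrixP fE] :
    (aff_vec R m.1, aff_mx R m.2) = (aff_vec R m'.1, aff_mx R m'.2).
  by rewrite -xm -xm'.
split.
  have := vE (Ordinal lt_i4) 0%R; rewrite !mxE /= => /(mulIf _) h.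
  by apply: (@intr_inj R); apply: h; rewrite invr_eq0 pnatr_eq0.
have lt_f := aff_index i fP'.
have := fE (Ordinal lt_i4) (Ordinal lt_f); rewrite !mxE /= eqxx.
by case: eqP => // _ /eqP; rewrite eq_sym oner_eq0.
Qed.

(** On a coordinate fixed by the permutation, [x] is a translation, and its n-th power translates n
    times as far. *)
Lemma is_aff_torsion x m n i : is_aff x m -> (i < 4)%N -> nth 0%N m.2 i = i ->
  (0 < n)%N -> x ^+ n = 1 -> nth 0%R m.1 i = 0%R.
Proof.
move=> xm lt_i4 fi n_gt0 xn1.
have [m' [xm' fi' wi']] : exists m', [/\ is_aff (x ^+ n) m',
    nth 0%N m'.2 i = i & nth 0%R m'.1 i = (nth 0%R m.1 i *+ n)%R].
  elim: n {n_gt0 xn1} => [|n [m' [xm' fi' wi']]].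
    exists aff_one; split; [exact: is_aff1|by rewrite nth_iota|].
    by rewrite nth_nseq if_same.
  exists (aff_mul m m'); rewrite expgS; split; first exact: is_affM.
    by rewrite (nth_map 0%N) ?size_iota // nth_iota // add0n fi fi'.
  by rewrite (nth_map 0%N) ?size_iota // nth_iota // add0n fi wi' mulrS.
have x1 : is_aff (x ^+ n) aff_one by rewrite xn1; exact: is_aff1.
have [+ _] := is_aff_uniq xm' x1 lt_i4.
rewrite wi' nth_nseq if_same => /eqP.
by rewrite mulrn_eq0 eqn0Ngt n_gt0 /= => /eqP.
Qed.

Lemma is_aff_transV x (p q r s : int) : is_aff x ([:: p; q; r; s], iota 0 4) ->
  is_aff x^-1 ([:: - p; - q; - r; - s]%R, iota 0 4).
Proof.
move=> xt; apply: (is_affV xt) => //.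
by rewrite /aff_mul /= !subrr.
Qed.

Lemma is_aff_transX x (p q r s : int) z :
  is_aff x ([:: p; q; r; s], iota 0 4) ->
  is_aff (expgz x z) ([:: z * p; z * q; z * r; z * s]%R, iota 0 4).
Proof.
move=> xt; elim/int_ind: z => [|n IH|n IH].
- by rewrite /= !mul0r; exact: is_aff1.
- rewrite -(addn1 n) PoszD expgzD1; apply: is_aff_eq (is_affM IH xt) _.
  by rewrite /aff_mul /= !mulrDl !mul1r.
- rewrite -(addn1 n) PoszD opprD expgzB1.
  apply: is_aff_eq (is_affM IH (is_aff_transV xt)) _.
  by rewrite /aff_mul /= !mulrBl !mul1r.
Qed.

Lemma euclid_gen_relation u v :
  braid3_relation u v ->
  word_eval (@euclid_gen R) u = word_eval (@euclid_gen R) v.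
Proof.
case=> -> ->; rewrite /word_eval !big_cons !big_nil /= !mulg1 !mulgA.
exact: euclid_gen_braid.
Qed.

Definition affine_rep : {multiplicative B3 -> euclid R 4} :=
  presented_lift euclid_gen_relation.

Lemma affine_rep_sigma b : affine_rep (sigma b) = @euclid_gen R b.
Proof. by rewrite /affine_rep /= presented_lift_gen. Qed.

Lemma is_aff_sigma b : is_aff (affine_rep (sigma b)) (aff_gen b).
Proof. rewrite affine_rep_sigma; exact: is_aff_gen. Qed.

Lemma is_aff_sigmaV b : is_aff (affine_rep (sigma b)^-1) (aff_genV b).
Proof. rewrite kernel_fV affine_rep_sigma; exact: is_aff_genV. Qed.

Lemma is_aff_repM (x y : B3) m m' : is_aff (affine_rep x) m ->
  is_aff (affine_rep y) m' -> is_aff (affine_rep (x * y)) (aff_mul m m').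
Proof. by move=> xm ym; rewrite gmulfM; exact: is_affM. Qed.

Lemma is_aff_repX (x : B3) m n : is_aff (affine_rep x) m ->
  is_aff (affine_rep (x ^+ n)) (iter n (aff_mul m) aff_one).
Proof.
move=> xm; elim: n => [|n IH]; first by rewrite expg0 kernel_f1; exact: is_aff1.
by rewrite expgS iterS; exact: is_aff_repM.
Qed.

Lemma is_aff_exists (x : B3) : exists m, is_aff (affine_rep x) m.
Proof.
elim/sigma_ind: x => [|x [m xm]|x [m xm]|x [m xm]|x [m xm]].
- by exists aff_one; rewrite kernel_f1; exact: is_aff1.
- exact: ex_intro (is_aff_repM (is_aff_sigma _) xm).
- exact: ex_intro (is_aff_repM (is_aff_sigma _) xm).
- exact: ex_intro (is_aff_repM (is_aff_sigmaV _) xm).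
- exact: ex_intro (is_aff_repM (is_aff_sigmaV _) xm).
Qed.

(** Lengths are in sixths, so 6 is a unit step; [minn i 3] matches the repetition of the last
    cusp. *)
Lemma is_aff_cusp i : is_aff (affine_rep (cusp3 i))
  ([seq Posz (6 * (minn i 3 == k)) | k <- iota 0 4], iota 0 4).
Proof.
have a := is_aff_sigma false; have b := is_aff_sigma true.
have a3 := is_aff_repX 3 a; have b3 := is_aff_repX 3 b.
case: i => [|[|[|i]]].
- by apply: is_aff_eq a3 _.
- by apply: is_aff_eq (is_aff_repM (is_aff_repM b a3) (is_aff_sigmaV true)) _.
- by apply: is_aff_eq b3 _.
- apply: is_aff_eq (is_aff_repM (is_aff_repM a b3) (is_aff_sigmaV false)) _.
  by [].
Qed.

Lemma is_aff_twist :
  is_aff (affine_rep twist3) ([:: 3; 3; 3; 3]%R, iota 0 4).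
Proof.
have a := is_aff_sigma false; have b := is_aff_sigma true.
by apply: is_aff_eq (is_aff_repX 3 (is_aff_repM a b)) _.
Qed.

Definition aff_rep (j m : nat) : aff :=
  aff_mul
    match j with
    | 0 => aff_one
    | 1 => aff_gen true
    | 2 => aff_mul (aff_gen false) (aff_gen true)
    | _ => aff_mul (aff_genV false) (aff_gen true)
    end (iter m (aff_mul (aff_gen false)) aff_one).

Lemma is_aff_rep j (m : nat) :
  is_aff (affine_rep (cusp_rep3 j * sigma false ^+ m)) (aff_rep j m).
Proof.
have a := is_aff_sigma false; have b := is_aff_sigma true.
apply: is_aff_repM (is_aff_repX m a).
case: j => [|[|[|j]]] /=.
- by rewrite kernel_f1; exact: is_aff1.
- exact: b.
- exact: is_aff_repM.
- by apply: is_aff_repM b; exact: is_aff_sigmaV.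
Qed.

Lemma is_aff_linear1 x (w : seq int) :
  is_aff x (w, iota 0 4) -> (val x).2 = 1%:M%R.
Proof.
move=> [_ ->] /=; have [_] := is_aff1 R; rewrite /aff_one.
by move/(congr1 snd) => /= <-.
Qed.

Lemma cusp_group_translation n :
  cusp_group3 n -> (val (affine_rep n)).2 = 1%:M%R.
Proof.
elim=> {n} [|n [->|[i ->]]|x y _ IHx _ IHy|x _ IHx].
- by rewrite kernel_f1.
- exact: is_aff_linear1 is_aff_twist.
- exact: is_aff_linear1 (is_aff_cusp i).
- by rewrite gmulfM /= IHx IHy mulmx1.
- by rewrite kernel_fV /= IHx trmx1.
Qed.

(** Removing the factor from N leaves a central representative, which must be trivial. *)
Lemma central_cusp_group (x : B3) : rho3_central x -> cusp_group3 x.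
Proof.
have [j [m [n [lt_j4 lt_m3 Nn ->]]]] :=
  cusp_decomposition sigma_braid sigma_ind x.
move=> xC; have /(rho3_central_rep lt_j4 lt_m3)[-> ->] :
    rho3_central (cusp_rep3 j * sigma false ^+ m).
  rewrite -[_ * _](mulgK n); apply: rho3_centralM => //.
  exact/rho3_centralV/cusp_group_central.
by rewrite expg0 !mul1g.
Qed.

Lemma level3_central (x : B3) : x \in B3_level3 -> rho3_central x.
Proof.
move=> /eqP x1; apply: (rho3_central_scalar (c := 1%R)).
by rewrite /rho3_mx x1 GL_1E.
Qed.

Lemma euclid_translationC x y :
  (val x).2 = 1%:M%R -> (val y).2 = 1%:M%R -> commute x y.
Proof.
move=> x1 y1; apply/val_inj.
rewrite /= x1 y1 !mulmx1; congr pair.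
by rewrite !mul1mx addrC.
Qed.

Lemma affine_rep_derived (x : B3) : x \in derived B3_level3 -> affine_rep x = 1.
Proof.
apply: derived_gmulf1 x => x y /level3_central/central_cusp_group xN.
move=> /level3_central/central_cusp_group yN.
by apply: euclid_translationC; exact: cusp_group_translation.
Qed.

Definition affine_quot : B3_mod_derived -> euclid R 4 :=
  @quotg_lift _ (derived B3_level3) _ affine_rep.

Lemma affine_quotM : {morph affine_quot : x y / x * y}.
Proof. exact: quotg_liftM affine_rep_derived. Qed.

HB.instance Definition _ := isMultiplicative.Build B3_mod_derived (euclid R 4)
  affine_quot affine_quotM.

Lemma affine_quot_proj (x : B3) :
  affine_quot (quotg_proj (derived B3_level3) x) = affine_rep x.
Proof. exact: (quotg_lift_proj affine_rep_derived). Qed.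

End AffineAction.

(** * The translation lattice *)

Local Notation piB := (quotg_proj (derived B3_level3)).

(** The basis is e_1, e_2, e_3, c; the relation c^2 = e_0 e_1 e_2 e_3 accounts for e_0. *)
Definition lattice_gen (k : nat) : B3_mod_derived :=
  piB (if (k < 3)%N then cusp3 k.+1 else twist3).

Lemma level3_commute (x y : B3) :
  x \in B3_level3 -> y \in B3_level3 -> commute (piB x) (piB y).
Proof.
move=> xK yK; rewrite /commute -!gmulfM commgC gmulfM.
rewrite [X in _ * X]quotg_proj_eq1 ?mulg1 //.
by rewrite inE; apply: generated_sub; exists x => //; exists y.
Qed.

(** The cusps lie in K, so they commute modulo [K, K]; the twist, whose image is -1, does not lie in
    K but is central in B_3. *)
Lemma lattice_gen_commute i j : commute (lattice_gen i) (lattice_gen j).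
Proof.
have T x : commute (piB twist3) x.
  rewrite -[x]quotg_proj_repr; apply: gmulf_commute.
  exact: (twistC sigma_braid sigma_ind).
have C k l : commute (piB (cusp3 k)) (piB (cusp3 l)).
  by apply: level3_commute; exact: cusp_level3.
rewrite /lattice_gen; case: ifP => _; last exact: T.
by case: ifP => _; [exact: C|exact/commute_sym/T].
Qed.

Definition lattice (c : nat -> int) : B3_mod_derived :=
  \prod_(k <- iota 0 4) expgz (lattice_gen k) (c k).

Lemma eq_lattice c c' : (forall k, (k < 4)%N -> c k = c' k) ->
  lattice c = lattice c'.
Proof.
move=> cc'; rewrite /lattice !big_seq; apply: eq_bigr => k.
by rewrite mem_iota add0n => /andP[_ /cc' ->].
Qed.

Lemma latticeD c c' : lattice (fun k => c k + c' k)%R = lattice c * lattice c'.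
Proof.
rewrite /lattice -prodgM_commute.
  by apply: eq_bigr => k _; exact: expgzD.
by move=> i j _ _; apply: commute_expgz; exact: lattice_gen_commute.
Qed.

Lemma lattice0 : lattice (fun=> 0%R) = 1.
Proof. by rewrite /lattice big1. Qed.

Lemma latticeN c : lattice (fun k => - c k)%R = (lattice c)^-1.
Proof.
apply: (mulgI (lattice c)); rewrite -latticeD mulgV -lattice0.
by apply: eq_lattice => k _; rewrite subrr.
Qed.

Lemma lattice_commute c c' : commute (lattice c) (lattice c').
Proof.
by rewrite /commute -!latticeD; apply: eq_lattice => k _; rewrite addrC.
Qed.

Lemma lattice_delta k : (k < 4)%N ->
  lattice (fun i => Posz (i == k)) = lattice_gen k.
Proof.
by rewrite /lattice; case: k => [|[|[|[|//]]]] _;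
  rewrite !big_cons big_nil /= ?expg0 ?expg1 ?mul1g ?mulg1.
Qed.

Lemma cusp_group_lattice n : cusp_group3 n -> exists c, piB n = lattice c.
Proof.
have gen k : (k < 4)%N -> exists c, lattice_gen k = lattice c.
  by move=> lt_k; exists (fun i => Posz (i == k)); rewrite lattice_delta.
have latM x y : (exists c, x = lattice c) -> (exists c, y = lattice c) ->
    exists c, x * y = lattice c.
  by move=> [c ->] [c' ->]; rewrite -latticeD; eexists.
have latV x : (exists c, x = lattice c) -> exists c, x^-1 = lattice c.
  by move=> [c ->]; rewrite -latticeN; eexists.
elim=> {n} [|n [->|[i ->]]|x y _ IHx _ IHy|x _ IHx].
- by exists (fun=> 0%R); rewrite lattice0 (kernel_f1 piB).
- exact: (gen 3%N).
- case: i => [|[|[|i]]]; last exact: (gen 2%N); last exact: (gen 1%N);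
    last exact: (gen 0%N).
  (* The relation [twist_cusps] solved for e_0. *)
  have -> : cusp3 0 = twist3 ^+ 2 * (cusp3 1 * cusp3 2 * cusp3 3)^-1.
    have mulA3 (p q r s : B3) : p * (q * r * s) = p * q * r * s.
      by rewrite !mulgA.
    apply: (mulIg (cusp3 1 * cusp3 2 * cusp3 3)); rewrite mulgVK mulA3.
    by rewrite -(twist_cusps sigma_braid).
  rewrite expg2 gmulfM (kernel_fV piB); apply: (latM _ _).
    by rewrite gmulfM; apply: (latM _ _); exact: (gen 3%N).
  apply: (latV _); rewrite gmulfM; apply: (latM _ _); last exact: (gen 2%N).
  by rewrite gmulfM; apply: (latM _ _); [exact: (gen 0%N)|exact: (gen 1%N)].
- by rewrite gmulfM; exact: latM.
- by rewrite (kernel_fV piB); exact: latV.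
Qed.

Lemma lattice_decomposition (x : B3_mod_derived) : exists j m c,
  [/\ (j < 4)%N, (m < 3)%N &
    x = piB (cusp_rep3 j * sigma false ^+ m) * lattice c].
Proof.
have [j [m [n [lt_j lt_m Nn xE]]]] :=
  cusp_decomposition sigma_braid sigma_ind (repr x : B3).
have [c nE] := cusp_group_lattice Nn.
exists j, m, c; split=> //.
rewrite -nE -gmulfM -xE; exact/esym/quotg_proj_repr.
Qed.

(** * Faithfulness of the affine action and absence of torsion *)

Section Embedding.
Variable R : realType.
Local Notation affine_quot := (@affine_quot R).

(** The translation vector in sixths; coordinate 0 sees only the twist, because e_0 is not in the
    basis. *)
Definition lattice_vec (c : nat -> int) : seq int :=
  [:: 3 * c 3; 6 * c 0 + 3 * c 3; 6 * c 1 + 3 * c 3; 6 * c 2 + 3 * c 3]%R.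

Lemma is_aff_lattice c :
  is_aff (affine_quot (lattice c)) (lattice_vec c, iota 0 4).
Proof.
rewrite /lattice !big_cons big_nil mulg1 !gmulfM.
rewrite !gmulf_expgz /= !affine_quot_proj.
have e1 := is_aff_transX (c 0%N) (is_aff_cusp R 1).
have e2 := is_aff_transX (c 1%N) (is_aff_cusp R 2).
have e3 := is_aff_transX (c 2%N) (is_aff_cusp R 3).
have t := is_aff_transX (c 3%N) (is_aff_twist R).
apply: is_aff_eq (is_affM e1 (is_affM e2 (is_affM e3 t))) _.
rewrite /aff_mul /lattice_vec /=; congr pair; do ![congr cons]; ring.
Qed.

Lemma is_aff_decomposition j m c :
  is_aff (affine_quot (piB (cusp_rep3 j * sigma false ^+ m) * lattice c))
    (aff_mul (aff_rep j m) (lattice_vec c, iota 0 4)).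
Proof.
rewrite affine_quotM affine_quot_proj.
apply: is_affM; first exact: is_aff_rep.
exact: is_aff_lattice.
Qed.

Lemma lattice_vec_eq0 c :
  (forall i, (i < 4)%N -> nth 0%R (lattice_vec c) i = 0%R) ->
  forall k, (k < 4)%N -> c k = 0%R.
Proof.
move=> w0 k.
have := w0 0%N isT; have := w0 1%N isT; have := w0 2%N isT; have := w0 3%N isT.
rewrite /=; case: k => [|[|[|[|//]]]] /=.
all: by move: (c 0%N) (c 1%N) (c 2%N) (c 3%N); lia.
Qed.

Lemma lattice_vec_lattice1 c :
  (forall i, (i < 4)%N -> nth 0%R (lattice_vec c) i = 0%R) -> lattice c = 1.
Proof. by move=> /lattice_vec_eq0 c0; rewrite -lattice0; exact: eq_lattice. Qed.

Lemma affine_quot_inj : injective affine_quot.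
Proof.
apply: gmulf_injective => x.
have [j [m [c [lt_j lt_m ->]]]] := lattice_decomposition x.
move=> x1; have := is_aff_decomposition j m c; rewrite x1 => xm.
have uniq_aff := is_aff_uniq xm (is_aff1 R).
(* Among the twelve linear parts, which are even permutations, only the identity fixes both
   coordinates 0 and 1. *)
have [j0 m0] : j = 0%N /\ m = 0%N.
  have [_ f0] := uniq_aff 0%N isT; have [_ f1] := uniq_aff 1%N isT.
  move: lt_j lt_m f0 f1 {xm x1 uniq_aff}.
  by case: j => [|[|[|[|//]]]]; case: m => [|[|[|//]]].
rewrite j0 m0 expg0 mulg1 (kernel_f1 piB) mul1g.
apply: lattice_vec_lattice1 => i lt_i4.
have [+ _] := uniq_aff i lt_i4; rewrite j0 m0.
by case: i lt_i4 => [|[|[|[|//]]]] _ /=; rewrite !add0r.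
Qed.

Lemma B3_mod_derived_torsion_free : torsion_free B3_mod_derived.
Proof.
move=> x n n_gt0 xn1.
have [j [m [c [lt_j lt_m xE]]]] := lattice_decomposition x.
have yn1 : affine_quot x ^+ n = 1.
  by rewrite -gmulf_expgn xn1 (kernel_f1 affine_quot).
have := is_aff_decomposition j m c; rewrite -xE => ym.
have y2n1 : (affine_quot x * affine_quot x) ^+ n = 1.
  by rewrite expgMn // yn1 mulg1.
have y2m := is_affM ym ym.
have fixed i lt_i fi := is_aff_torsion (i := i) ym lt_i fi n_gt0 yn1.
have fixed2 i lt_i fi := is_aff_torsion (i := i) y2m lt_i fi n_gt0 y2n1.
move: lt_j lt_m xE {ym y2m} fixed fixed2.
case: j => [|[|[|[|//]]]] _; case: m => [|[|[|//]]] _ xE fixed fixed2.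
  rewrite xE expg0 mulg1 (kernel_f1 piB) mul1g.
  apply: lattice_vec_lattice1 => i lt_i4.
  by case: i lt_i4 => [|[|[|[|//]]]] lt_i4;
    have /= := fixed _ lt_i4 erefl; rewrite !add0r.
all: exfalso.
(* A 3-cycle has a fixed coordinate, where the displacement in sixths is prime to 3. A double
   transposition has none, but its square displaces coordinate 0 by an odd multiple of 3. *)
all: first
  [ have /= := fixed 0%N isT erefl | have /= := fixed 1%N isT erefl
  | have /= := fixed 2%N isT erefl | have /= := fixed 3%N isT erefl
  | have /= := fixed2 0%N isT erefl ].
all: move: (c 0%N) (c 1%N) (c 2%N) (c 3%N); lia.
Qed.

End Embedding.

(** * The holonomy *)

Section Holonomy.

Definition proj_rho3 (x : B3) : PSp2_F3 :=
  subg _ (coset 'Z(Sp2_F3_group) (sgval (rho3 x))).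

Lemma Sp2_norm_center (x : B3) : sgval (rho3 x) \in 'N('Z(Sp2_F3_group)).
Proof.
exact: (fintype.subsetP (normal_norm (center_normal Sp2_F3_group)) _ (subgP _)).
Qed.

Lemma proj_rho3_mem (x : B3) :
  coset 'Z(Sp2_F3_group) (sgval (rho3 x)) \in
    (Sp2_F3_group / 'Z(Sp2_F3_group))%G.
Proof. by apply: mem_quotient; exact: subgP. Qed.

Lemma proj_rho3M : {morph proj_rho3 : x y / x * y}.
Proof.
move=> x y; apply: val_inj; rewrite /proj_rho3.
rewrite gmulfM sgvalM ?in_setT // morphM ?Sp2_norm_center //.
by rewrite subgM ?proj_rho3_mem.
Qed.

HB.instance Definition _ :=
  isMultiplicative.Build B3 PSp2_F3 proj_rho3 proj_rho3M.

Lemma proj_rho3_eq1 x : (proj_rho3 x = 1) <-> rho3_central x.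
Proof.
split=> [/(congr1 sgval)|xZ].
  rewrite /proj_rho3 subgK ?proj_rho3_mem // => /coset_idr; apply.
  exact: Sp2_norm_center.
by apply: val_inj; rewrite /= subgK ?proj_rho3_mem // coset_id.
Qed.

Lemma proj_rho3_surj q : exists x, proj_rho3 x = q.
Proof.
have /morphimP[g _ gS qE] := subgP q.
have [x xg] := rho3_surj gS; exists x.
by apply: val_inj; rewrite /= subgK ?proj_rho3_mem // xg qE.
Qed.

Lemma derived_sub (G : groupType) (N : normalClosed G) x :
  x \in derived N -> x \in N.
Proof.
rewrite inE; elim=> {x} [|x [a Na [b Nb <-]]|x y _ Nx _ Ny|x _ Nx].
- exact: gpred1.
- by rewrite gpredR.
- exact: gpredM.
- by rewrite gpredV.
Qed.

Lemma proj_rho3_derived x : x \in derived B3_level3 -> proj_rho3 x = 1.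
Proof. by move=> /derived_sub/level3_central xZ; exact/proj_rho3_eq1. Qed.

Definition holonomy_proj : B3_mod_derived -> PSp2_F3 :=
  @quotg_lift _ (derived B3_level3) _ proj_rho3.

Lemma holonomy_projM : {morph holonomy_proj : x y / x * y}.
Proof. exact: quotg_liftM proj_rho3_derived. Qed.

HB.instance Definition _ := isMultiplicative.Build B3_mod_derived PSp2_F3
  holonomy_proj holonomy_projM.

Lemma holonomy_proj_quot x : holonomy_proj (piB x) = proj_rho3 x.
Proof. exact: (quotg_lift_proj proj_rho3_derived). Qed.

Lemma holonomy_proj_lattice c : holonomy_proj (lattice c) = 1.
Proof.
have gen1 k : holonomy_proj (lattice_gen k) = 1.
  rewrite /lattice_gen holonomy_proj_quot; apply/proj_rho3_eq1.
  apply: cusp_group_central.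
  by case: ifP => _; [exact: cusp_group_cusp|exact: cusp_group_twist].
have genX1 k z : holonomy_proj (expgz (lattice_gen k) z) = 1.
  rewrite gmulf_expgz /= gen1.
  by case: z => n; rewrite /= expg1n ?invg1.
by rewrite /lattice !big_cons big_nil mulg1 !holonomy_projM !genX1 !mulg1.
Qed.

Lemma holonomy_proj_eq1 x : holonomy_proj x = 1 <-> exists c, x = lattice c.
Proof.
split=> [|[c ->]]; last exact: holonomy_proj_lattice.
rewrite -[x]quotg_proj_repr holonomy_proj_quot.
by move=> /proj_rho3_eq1/central_cusp_group; exact: cusp_group_lattice.
Qed.

Lemma holonomy_proj_surj q : exists x, holonomy_proj x = q.
Proof.
by have [x <-] := proj_rho3_surj q; exists (piB x); rewrite holonomy_proj_quot.
Qed.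

Definition lattice_of (u : 'cV[int]_4) : B3_mod_derived :=
  lattice (fun k => u (inord k) 0%R).

Lemma lattice_ofE c : lattice c = lattice_of (\col_k c k)%R.
Proof. by apply: eq_lattice => k lt_k; rewrite mxE inordK. Qed.

Lemma lattice_ofD : {morph lattice_of : u v / (u + v)%R >-> u * v}.
Proof.
move=> u v; rewrite /lattice_of -latticeD.
by apply: eq_lattice => k _; rewrite mxE.
Qed.

(** Independence of the basis is read off the translation vectors of the affine action. *)
Lemma lattice_of_inj (R : realType) : injective lattice_of.
Proof.
have lattice_of_eq1 u : lattice_of u = 1 -> u = 0%R.
  move=> /(congr1 (@affine_quot R)); rewrite (kernel_f1 (@affine_quot R)) => u1.
  have := is_aff_lattice R (fun k => u (inord k) 0%R).
  rewrite -/(lattice_of u) u1 => /is_aff_uniq /(_ (is_aff1 R)) h.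
  apply/colP=> k; rewrite mxE -[in LHS](inord_val k).
  apply: (@lattice_vec_eq0 (fun k => u (inord k) 0%R) _ k) => // i lt_i4.
  by have [-> _] := h i lt_i4; rewrite nth_nseq if_same.
move=> u v uv; apply/eqP; rewrite -subr_eq0; apply/eqP/lattice_of_eq1.
by apply: (mulIg (lattice_of v)); rewrite -lattice_ofD subrK mul1g.
Qed.

(** Conjugation by a chosen lift of [q]; [holonomy_actionP] shows that the choice does not matter
    and that the default 0 is never taken. *)
Definition holonomy_action (q : PSp2_F3) (u : 'cV[int]_4) : 'cV[int]_4 :=
  xget 0%R [set v | exists2 g, holonomy_proj g = q &
    lattice_of v = g * lattice_of u * g^-1].

Lemma holonomy_actionP g u :
  lattice_of (holonomy_action (holonomy_proj g) u) = g * lattice_of u * g^-1.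
Proof.
have [v vP] : exists v, lattice_of v = g * lattice_of u * g^-1.
  have /holonomy_proj_eq1[c cE] : holonomy_proj (g * lattice_of u * g^-1) = 1.
    rewrite !holonomy_projM holonomy_proj_lattice mulg1 -holonomy_projM mulgV.
    exact: (kernel_f1 holonomy_proj).
  by exists (\col_k c k)%R; rewrite -lattice_ofE.
rewrite /holonomy_action.
case: xgetP => [w _ [h hg ->]|/(_ v)[]]; last by exists g.
(* Two lifts differ by a lattice element, which commutes with the lattice. *)
have /holonomy_proj_eq1[c cE] : holonomy_proj (g^-1 * h) = 1.
  by rewrite holonomy_projM hg -holonomy_projM mulVg (kernel_f1 holonomy_proj).
have -> : h = g * lattice c by rewrite -cE mulVKg.
rewrite invgM !mulgA; congr (_ * _); rewrite -!mulgA; congr (_ * _).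
by rewrite mulgA (lattice_commute c) mulgK.
Qed.

(** A nontrivial even permutation moves coordinate 1 or 2, so commutation fails for the translation
    by e_1 or e_2. *)
Lemma aff_rep_commute j m : (j < 4)%N -> (m < 3)%N ->
  (forall d i, (i < 4)%N ->
    nth 0%R (aff_mul (aff_rep j m) (lattice_vec d, iota 0 4)).1 i =
    nth 0%R (aff_mul (lattice_vec d, iota 0 4) (aff_rep j m)).1 i) ->
  j = 0%N /\ m = 0%N.
Proof.
case: j => [|[|[|[|//]]]] _; case: m => [|[|[|//]]] _ // yw; exfalso.
all: first
  [ by have /eqP := yw (fun k => Posz (k == 0)%N) 1%N isT
  | by have /eqP := yw (fun k => Posz (k == 1)%N) 2%N isT ].
Qed.

(** Lifts with the same action differ by an element centralizing the lattice; its coset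
    representative then also centralizes it, and is trivial. *)
Lemma holonomy_action_inj (R : realType) : injective holonomy_action.
Proof.
move=> q q'; have [g <-] := holonomy_proj_surj q.
have [h <-] := holonomy_proj_surj q' => gh.
have comm c : commute (h^-1 * g) (lattice c).
  have := holonomy_actionP h (\col_k c k)%R.
  rewrite -gh holonomy_actionP -!lattice_ofE => E.
  apply: (mulgI h); apply: (mulIg g^-1).
  by rewrite !mulgA mulgV mul1g E mulgK.
have [j [m [c [lt_j lt_m hgE]]]] := lattice_decomposition (h^-1 * g).
pose y := piB (cusp_rep3 j * sigma false ^+ m).
have ycomm d : commute y (lattice d).
  have -> : y = (h^-1 * g) * (lattice c)^-1 by rewrite hgE mulgK.
  apply: commute_sym; apply: commuteM; first exact/commute_sym/comm.
  exact/commuteV/lattice_commute.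
have ym : is_aff (@affine_quot R y) (aff_rep j m).
  by rewrite affine_quot_proj; exact: is_aff_rep.
have yw d i : (i < 4)%N ->
    nth 0%R (aff_mul (aff_rep j m) (lattice_vec d, iota 0 4)).1 i =
    nth 0%R (aff_mul (lattice_vec d, iota 0 4) (aff_rep j m)).1 i.
  move=> lt_i; have yd := is_affM ym (is_aff_lattice R d).
  have dy := is_affM (is_aff_lattice R d) ym.
  move: yd; rewrite -affine_quotM ycomm affine_quotM => yd.
  exact: (is_aff_uniq yd dy lt_i).1.
have [j0 m0] := aff_rep_commute lt_j lt_m yw.
have hg1 : holonomy_proj (h^-1 * g) = 1.
  apply/holonomy_proj_eq1; exists c.
  by rewrite hgE j0 m0 expg0 mulg1 (kernel_f1 piB) mul1g.
by rewrite -(mulVKg h g) holonomy_projM hg1 mulg1.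
Qed.

Lemma B3_mod_derived_holonomy (R : realType) :
  has_holonomy 4 B3_mod_derived PSp2_F3.
Proof.
exists lattice_of, holonomy_proj, holonomy_action; split.
- exact: (lattice_of_inj R).
- exact: lattice_ofD.
- apply/seteqP; split=> [_ [u _ <-]|x /=].
    by apply/eqP; exact: holonomy_proj_lattice.
  move=> /eqP/holonomy_proj_eq1[c ->]; exists (\col_k c k)%R => //.
  by rewrite -lattice_ofE.
- apply/seteqP; split=> // q _.
  by have [x <-] := holonomy_proj_surj q; exists x.
- split; last exact: (holonomy_action_inj R).
  by move=> g v; exact: holonomy_actionP.
Qed.

End Holonomy.

(** * The theorem *)

Section Crystallographic.
Variable R : realType.

Definition affine_image : {pred euclid R 4} := mem (range (@affine_quot R)).

Lemma affine_image1 : 1 \in affine_image.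
Proof. by rewrite inE; exists 1 => //; exact: kernel_f1. Qed.

Lemma affine_imageM : mulg_closed affine_image.
Proof.
move=> x y; rewrite !inE => -[a _ <-] [b _ <-].
by exists (a * b) => //; exact: affine_quotM.
Qed.

Lemma affine_imageV : invg_closed affine_image.
Proof.
by move=> x; rewrite !inE => -[a _ <-]; exists a^-1 => //; exact: kernel_fV.
Qed.

HB.instance Definition _ :=
  isMulClosed.Build (euclid R 4) affine_image affine_imageM.
HB.instance Definition _ :=
  isMul1Closed.Build (euclid R 4) affine_image affine_image1.
HB.instance Definition _ :=
  isInvClosed.Build (euclid R 4) affine_image affine_imageV.

Lemma affine_image_discrete : discrete_subgroup affine_image.
Proof.
apply: (@discrete_subgroupP _ _ _ 6%:R%R) => // x; rewrite inE => -[a _ <-].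
rewrite -[a]quotg_proj_repr affine_quot_proj.
have [m [_ ->]] := is_aff_exists R (repr a); split=> i j; rewrite /= mxE.
  by rewrite mulrC divfK ?pnatr_eq0 // intr_int.
by case: eqP => _; [exact: rpred1|exact: rpred0].
Qed.

Lemma affine_image_uniform : uniform_subgroup affine_image.
Proof.
apply: uniform_subgroupP => u.
pose v k : int := u (inord k) 0%R.
(* The solution of [lattice_vec c = 6 v]: coordinate 0 forces c_3 = 2 v_0, and the others follow. *)
pose c k : int := if (k < 3)%N then (v k.+1 - v 0%N)%R else (2 * v 0%N)%R.
exists (affine_quot R (lattice c)); first by rewrite inE; exists (lattice c).
have [_ ->] := is_aff_lattice R c.
have [_ [_ <-]] := is_aff1 R; congr pair; apply/colP => k; rewrite !mxE /=.
have -> : nth 0%R (lattice_vec c) k = (6 * v k)%R.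
  rewrite /lattice_vec; case: k => [[|[|[|[|//]]]] ?] /=;
    by rewrite /c /=; ring.
by rewrite rmorphM /= mulrC mulKf ?pnatr_eq0 // /v inord_val.
Qed.

Lemma B3_mod_derived_crystallographic : crystallographic R 4 B3_mod_derived.
Proof.
pose Gamma : groupClosed (euclid R 4) := affine_image.
exists Gamma; split.
- exact: affine_image_discrete.
- exact: affine_image_uniform.
- exists (@affine_quot R); split; first exact: affine_quot_inj.
  by apply/seteqP; split=> x /=; rewrite inE.
Qed.

End Crystallographic.

Theorem theorem1p2 (R : realType) :
  bieberbach_with_holonomy R B3_mod_derived PSp2_F3.
Proof.
exists 4%N; split.
- exact: B3_mod_derived_crystallographic.
- exact: (B3_mod_derived_torsion_free R).
- exact: (B3_mod_derived_holonomy R).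
Qed.
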